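(* Let $M=\mathbb{R}^m$ with the Euclidean metric $g=(dx^1)^2+\cdots+(dx^m)^2$, and let $\sigma$ be a curve such that $j_{t_0}^{m-1}\sigma\in J^{m-1}(\mathbb{R},\mathbb{R}^m)$ is a Frenet jet. Then $$\dim\mathfrak{D}_{j_{t_0}^r\sigma}^r=\begin{cases}m+\tfrac12(2m-r-1)r,&1\le r\le m-1,\\ m+\binom m2,&r\ge m.\end{cases}$$ Hence $$N_r=\begin{cases}1+\binom{r+1}2,&1\le r\le m-1,\\ 1+\tfrac12m(2r-m+1),&r\ge m.\end{cases}$$ Moreover, the functions $t$ and $D_t^h\varkappa_i\colon(\pi_{m-1}^m)^{-1}\mathcal{F}^{m-1}(M)\subset J^m(\mathbb{R},M)\to\mathbb{R}$, $h+i\le m-1$ ($h\ge0$, $0\le i\le m-1$), are a basis for the algebra of differential invariants of order $\le m$.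
   Context: $J^r(\mathbb{R},M)$ is the bundle of $r$-jets of smooth curves in $M$, with projections $\pi_l^k\colon J^k(\mathbb{R},M)\to J^l(\mathbb{R},M)$. For a Killing field $X$ with flow $\phi_\tau$, $X^{(r)}$ is the vector field on $J^r(\mathbb{R},M)$ generating the flow $\phi_\tau^{(r)}(j_t^r\sigma)=j_t^r(\phi_\tau\circ\sigma)$; $\mathfrak{D}^r_{j_t^r\sigma}=\{X^{(r)}_{j_t^r\sigma}:X\text{ Killing}\}$. A differential invariant of order $r$ is a smooth function $f$ on (an open subset of) $J^r(\mathbb{R},M)$ with $X^{(r)}(f)=0$ for all Killing $X$; $N_r=m(r+1)+1-\operatorname{rk}\mathfrak{D}^r|_{\mathcal{U}^r}$ is the maximal number of functionally independent ones, $\mathcal{U}^r$ being the dense open subset on which the rank of $\mathfrak{D}^r$ is locally constant. A basis of differential invariants is a maximal functionally independent system. $D_t=\frac{\partial}{\partial t}+\sum_{r\ge0}x_{r+1}^i\frac{\partial}{\partial x_r^i}$ is the total derivative, with $x_r^i(j_t^k\sigma)=\frac{d^r(x^i\circ\sigma)}{dt^r}(t)$. Let $\nabla$ be the Levi-Civita connection and $T^\sigma$ the tangent field of $\sigma$. $\mathcal{F}^{m-1}(M)\subset J^{m-1}(\mathbb{R},M)$ is the open set of Frenet jets: those $j_t^{m-1}\sigma$ for which $T^\sigma,\nabla_{T^\sigma}T^\sigma,\dots,\nabla_{T^\sigma}^{m-2}T^\sigma$ are linearly independent at $t$. For a Frenet curve $\sigma$ in an oriented $M$ (one all of whose $(m-1)$-jets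 are Frenet), there are a unique positively oriented orthonormal frame $X_1^\sigma,\dots,X_m^\sigma$ along $\sigma$ and unique smooth functions $\kappa_0^\sigma,\dots,\kappa_{m-1}^\sigma$ (curvatures), $\kappa_j^\sigma>0$ for $0\le j\le m-2$, such that for $1\le i\le m-1$ the systems $(X_1^\sigma,\dots,X_i^\sigma)$ and $(T^\sigma,\dots,\nabla_{T^\sigma}^{i-1}T^\sigma)$ span the same subspace and are equally oriented, and $T^\sigma=\kappa_0^\sigma X_1^\sigma$, $\nabla_{X_1^\sigma}X_1^\sigma=\kappa_1^\sigma X_2^\sigma$, $\nabla_{X_1^\sigma}X_i^\sigma=-\kappa_{i-1}^\sigma X_{i-1}^\sigma+\kappa_i^\sigma X_{i+1}^\sigma$ ($2\le i\le m-1$), $\nabla_{X_1^\sigma}X_m^\sigma=-\kappa_{m-1}^\sigma X_{m-1}^\sigma$. The functions $\varkappa_i\colon(\pi_{m-1}^m)^{-1}\mathcal{F}^{m-1}(M)\to\mathbb{R}$, $0\le i\le m-1$, are defined by $\varkappa_i(j_t^m\sigma)=\kappa_i^\sigma(t)$ ($\varkappa_i$ depends only on the $(i+1)$-jet). *)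

(* Defs.v *)
From HB Require Import structures.
From mathcomp Require Import all_boot all_order all_algebra.
From mathcomp Require Import all_classical all_reals all_analysis.

Set Implicit Arguments.
Unset Strict Implicit.
Unset Printing Implicit Defensive.

Import Order.TTheory GRing.Theory Num.Theory.
Import numFieldNormedType.Exports.

Local Open Scope classical_set_scope.
Local Open Scope ring_scope.

(* For finite-dimensional V this is C^oo on the open set U: every iterated
   directional derivative exists and is Frechet differentiable on U. *)
Fixpoint iter_derive (R : realType) (V W : normedModType R) (f : V -> W)
    (vs : seq V) : V -> W :=
  if vs is v :: vs' then iter_derive (fun x => 'D_v f x) vs' else f.

Definition smooth_on (R : realType) (V W : normedModType R) (U : set V)
    (f : V -> W) : Prop :=
  forall (vs : seq V) (x : V), U x -> differentiable (iter_derive f vs) x.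

Definition is_flow (R : realType) (V : normedModType R) (X : V -> V)
    (phi : R -> V -> V) : Prop :=
  (forall x, phi 0 x = x) /\
  (forall x (tau : R), is_derive tau 1 (fun s => phi s x) (X (phi tau x))).

(* The set D is a linear subspace of dimension d. *)
Definition has_dim (R : realType) (V : vectType R) (D : set V) (d : nat) : Prop :=
  exists W : {vspace V}, (forall v, D v <-> v \in W) /\ \dim W = d.

Definition euclidean (R : realType) (m : nat) (x u v : 'rV[R]_m) : R :=
  \sum_(i < m) u 0 i * v 0 i.

(* (L_X g)(u, v) at x, for u and v extended to constant vector fields. *)
Definition lie_metric (R : realType) (m : nat)
    (g : 'rV[R]_m -> 'rV[R]_m -> 'rV[R]_m -> R) (X : 'rV[R]_m -> 'rV[R]_m)
    (x u v : 'rV[R]_m) : R :=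
  'D_(X x) (fun y => g y u v) x + g x ('D_u X x) v + g x u ('D_v X x).

Definition killing (R : realType) (m : nat) (X : 'rV[R]_m -> 'rV[R]_m) : Prop :=
  smooth_on setT X /\
  forall x u v, lie_metric (@euclidean R m) X x u v = 0.

(* J^r(RR, RR^m) in the global coordinates (t, x_0, ..., x_r); x_k is the k-th
   row of the second component. As this is a vector space it is also its own
   tangent space at every point. *)
Notation jets R m r := (R^o * 'M[R]_(r.+1, m))%type.

Definition smooth_curve (R : realType) (m : nat) (I : set R)
    (s : R -> 'rV[R]_m) : Prop :=
  open I /\ forall t, I t -> forall k, derivable (derive1n k s) t 1.

Definition jet (R : realType) (m r : nat) (s : R -> 'rV[R]_m) (t : R) :
    jets R m r :=
  (t, \matrix_(k < r.+1) (derive1n k s t)).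

Definition jet_proj (R : realType) (m k l : nat) (z : jets R m k) : jets R m l :=
  (z.1, \matrix_(j < l.+1) row (inord j) z.2).

(* F = f^(r), the map of r-jets induced by f : RR^m -> RR^m. *)
Definition prolonged_map (R : realType) (m r : nat) (f : 'rV[R]_m -> 'rV[R]_m)
    (F : jets R m r -> jets R m r) : Prop :=
  forall (I : set R) (s : R -> 'rV[R]_m) (t : R),
    smooth_curve I s -> I t -> F (jet r s t) = jet r (f \o s) t.

(* Xr = X^(r). Killing fields of Euclidean space are complete, so global flows
   lose nothing. *)
Definition prolongation (R : realType) (m r : nat) (X : 'rV[R]_m -> 'rV[R]_m)
    (Xr : jets R m r -> jets R m r) : Prop :=
  exists (phi : R -> 'rV[R]_m -> 'rV[R]_m) (Phi : R -> jets R m r -> jets R m r),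
    [/\ is_flow X phi,
        forall tau, prolonged_map (phi tau) (Phi tau)
      & is_flow Xr Phi].

Definition Ddist (R : realType) (m r : nat) (z : jets R m r) : set (jets R m r) :=
  [set v | exists X Xr, [/\ killing X, @prolongation R m r X Xr & v = Xr z]].

Definition Ureg (R : realType) (m r : nat) : set (jets R m r) :=
  [set z | exists d, \forall w \near z, has_dim (Ddist w) d].
Arguments Ureg : clear implicits.

(* N = N_r. *)
Definition is_Nr (R : realType) (m r N : nat) : Prop :=
  dense (Ureg R m r) /\
  forall z d, Ureg R m r z -> has_dim (Ddist z) d -> N = (m * r.+1 + 1 - d)%N.

Definition diff_invariant (R : realType) (m r : nat) (U : set (jets R m r))
    (f : jets R m r -> R) : Prop :=
  [/\ open U, smooth_on U (f : jets R m r -> R^o)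
    & forall X Xr, killing X -> prolongation X Xr ->
        forall z, U z -> 'D_(Xr z) (f : jets R m r -> R^o) z = 0].

(* The differentials of the f i are linearly independent at every point of U. *)
Definition fun_indep (R : realType) (m r : nat) (J : finType)
    (U : set (jets R m r)) (f : J -> jets R m r -> R) : Prop :=
  forall z, U z -> forall c : J -> R,
    (forall v, \sum_j c j * 'D_v (f j : jets R m r -> R^o) z = 0) ->
    forall j, c j = 0.

Definition adjoin (J T : Type) (f : J -> T) (g : T) (o : option J) : T :=
  if o is Some j then f j else g.

(* Maximality is tested on every open part of U, since an invariant need not
   be defined on the whole of U. *)
Definition is_basis (R : realType) (m r : nat) (J : finType)
    (U : set (jets R m r)) (f : J -> jets R m r -> R) : Prop :=
  [/\ forall j, diff_invariant U (f j),
      fun_indep U f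
    & forall (U' : set (jets R m r)) (g : jets R m r -> R),
        U' `<=` U -> U' !=set0 -> diff_invariant U' g ->
        ~ fun_indep U' (adjoin f g)].

Definition total_derivative (R : realType) (m k : nat) (f : jets R m k -> R) :
    jets R m k.+1 -> R :=
  fun z => 'D_((1, 0) : jets R m k) (f : jets R m k -> R^o) (jet_proj k z)
    + \sum_(l < k.+1) \sum_(i < m) z.2 (lift ord0 l) i *
        'D_((0, delta_mx l i) : jets R m k) (f : jets R m k -> R^o) (jet_proj k z).

Fixpoint iter_total_derivative (R : realType) (m k h : nat)
    (f : jets R m k -> R) : jets R m (h + k) -> R :=
  match h return jets R m (h + k) -> R with
  | 0 => f
  | h'.+1 => @total_derivative R m (h' + k) (@iter_total_derivative R m k h' f)
  end.
Arguments iter_total_derivative {R m k} h f z.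

(* The Levi-Civita connection of the Euclidean metric is flat: the covariant
   derivative of a vector field along s with respect to T^s is its ordinary
   derivative, so that nabla_T^k T = derive1n k.+1 s. *)
Definition frenet_at (R : realType) (m : nat) (s : R -> 'rV[R]_m) (t : R) : Prop :=
  row_free (\matrix_(k < m.-1) (derive1n k.+1 s t)).

Definition frenet_jets (R : realType) (m : nat) : set (jets R m m.-1) :=
  [set z | exists (I : set R) s t,
     [/\ smooth_curve I s, I t, frenet_at s t & z = jet m.-1 s t]].
Arguments frenet_jets : clear implicits.

Definition frenet_dom (R : realType) (m : nat) : set (jets R m m) :=
  jet_proj m.-1 @^-1` frenet_jets R m.
Arguments frenet_dom : clear implicits.

(* The two systems, given by the rows of A and of B, span the same subspace and
   are equally oriented. *)
Definition same_oriented_span (R : realType) (i m : nat) (A B : 'M[R]_(i, m)) :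
    Prop :=
  exists P : 'M[R]_i, 0 < \det P /\ A = P *m B.

(* X 1, ..., X m and kappa 0, ..., kappa m.-1 are the Frenet frame and the
   curvatures of the Frenet curve s on I; other indices are irrelevant. The
   covariant derivative with respect to X_1 is (kappa_0)^-1 times the one with
   respect to T = kappa_0 X_1. *)
Definition frenet_data (R : realType) (m : nat) (I : set R) (s : R -> 'rV[R]_m)
    (X : nat -> R -> 'rV[R]_m) (kappa : nat -> R -> R) : Prop :=
  let nablaX1 (Y : R -> 'rV[R]_m) t := (kappa 0%N t)^-1 *: derive1 Y t in
  [/\ smooth_curve I s /\ (forall t, I t -> frenet_at s t),
      (forall i, (1 <= i <= m)%N -> smooth_curve I (X i)) /\
      (forall i, (i < m)%N -> forall t, I t ->
         forall k, derivable (derive1n k (kappa i : R -> R^o)) t 1),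
      forall t, I t ->
        [/\ forall i j, (1 <= i <= m)%N -> (1 <= j <= m)%N ->
              euclidean (s t) (X i t) (X j t) = (i == j)%:R,
            0 < \det (\matrix_(k < m) (X k.+1 t))
          & forall i, (1 <= i <= m.-1)%N ->
              same_oriented_span (\matrix_(k < i) (derive1n k.+1 s t))
                                 (\matrix_(k < i) (X k.+1 t))],
      forall t, I t -> forall j, (j < m.-1)%N -> 0 < kappa j t
    & forall t, I t ->
        [/\ derive1 s t = kappa 0%N t *: X 1%N t,
            (2 <= m)%N -> nablaX1 (X 1%N) t = kappa 1%N t *: X 2%N t,
            forall i, (2 <= i <= m.-1)%N ->
              nablaX1 (X i) t
              = - kappa i.-1 t *: X i.-1 t + kappa i t *: X i.+1 t
          & (2 <= m)%N -> nablaX1 (X m) t = - kappa m.-1 t *: X m.-1 t]].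

(* varkappa_i (j_t^m s) = kappa_i^s (t); the value off frenet_dom is 0. *)
Definition varkappa (R : realType) (m i : nat) (z : jets R m m) : R :=
  xget 0 [set y | exists (I : set R) s X kappa,
    [/\ frenet_data I s X kappa, I z.1, jet m s z.1 = z & y = kappa i z.1]].

Definition time (R : realType) (m r : nat) (z : jets R m r) : R := z.1.

(* Main.v *)
(** A Killing field of Euclidean space is affine, X(x) = x A + b with A
    antisymmetric, so its prolongation at a jet (t, x_0, ..., x_r) is
    (0; x_0 A + b, x_1 A, ..., x_r A); hence the dimension of the distribution
    depends only on the rank of (x_1, ..., x_r), which is generically maximal.

    For a Frenet curve put c_k = <s^(k), X_k>. Since c_1 = kappa_0 and
    c_{k+1} = kappa_0 kappa_k c_k, and since c_1 ... c_k is the square root of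
    the Gram determinant of s', ..., s^(k) (for k = m, the determinant of
    s', ..., s^(m)), each curvature is an explicit smooth rotation-invariant
    function of the jet. The derivative of D_t^h varkappa_i in the top-order
    directions x_{h+i+1} is that of varkappa_i in the directions x_{i+1}, which
    makes the differentials of t and of the D_t^h varkappa_i triangular. As the
    number of these functions is the codimension of the distribution, no further
    invariant is independent of them. *)
From HB Require Import structures.
Require Import Defs.
From mathcomp Require Import all_boot all_order all_algebra.
From mathcomp Require Import all_classical all_reals all_analysis.
From mathcomp Require Import zify ring lra.
Set Implicit Arguments.
Unset Strict Implicit.
Unset Printing Implicit Defensive.
Import Order.TTheory GRing.Theory Num.Theory.
Import numFieldNormedType.Exports.
Local Open Scope classical_set_scope.
Local Open Scope ring_scope.

(** * Killing fields are affine *)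

(** Total derivatives raise the order of a jet, so [D_t^h varkappa_i] formally lives on jets of
    order [h + m]. To have all these functions on jets of order [m], the proof iterates a truncated
    total derivative that stays there; as long as [h + i < m], the discarded coordinate is never
    read. Many facts about derivatives rest on one remark: a directional derivative sees only the
    values of a function on a line. Rotation invariance and independence of high coordinates
    therefore pass from a function to its derivative without a chain rule. [varkappa] chooses among
    the Frenet data of all curves with a given jet. Uniqueness identifies whatever is chosen with an
    explicit formula; existence of a Frenet frame shows that there is something to choose. The last
    curvature has no sign. Hence the volume in top dimension is a determinant instead of a square
    root, and the derivative of the last curvature is tested along a normal vector, where it cannot
    vanish. *)

Lemma is_derive_mxP (R : realType) (V : normedModType R) (p q : nat)
    (M : V -> 'M[R]_(p, q)) (t v : V) (D : 'M[R]_(p, q)) :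
  is_derive t v M D <->
  forall i j, is_derive t v (fun x => M x i j : R) (D i j).
Proof.
split=> [[dM <-] i j|dM].
  apply: DeriveDef; first by move/derivable_mxP: dM.
  by rewrite derive_mx // mxE.
have dM' : derivable M t v by apply/derivable_mxP => i j; case: (dM i j).
apply: DeriveDef => //; rewrite derive_mx //.
by apply/matrixP=> i j; rewrite mxE; case: (dM i j).
Qed.

Lemma is_derive_pair (R : realType) (V W1 W2 : normedModType R)
    (f : V -> W1) (g : V -> W2) (t v : V) (df : W1) (dg : W2) :
  is_derive t v f df -> is_derive t v g dg ->
  is_derive t v (fun x => (f x, g x)) (df, dg).
Proof.
move=> [cf <-] [cg <-].
have H : ((fun h => h^-1 *: (((fun x => (f x, g x)) \o shift t) (h *: v) -
      (f t, g t))) @ 0^' --> ('D_v f t, 'D_v g t)).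
  exact: (cvg_pair cf cg).
apply: DeriveDef; first by apply: cvgP H.
exact: cvg_lim H.
Qed.

Lemma is_derive_fst (R : realType) (V W1 W2 : normedModType R)
    (f : V -> W1 * W2) (t v : V) (df : W1 * W2) :
  is_derive t v f df -> is_derive t v (fun x => (f x).1) df.1.
Proof.
move=> [cf <-].
have H : ((fun h => h^-1 *: (((fun x => (f x).1) \o shift t) (h *: v) -
      (f t).1)) @ 0^' --> ('D_v f t).1).
  apply: (@cvg_comp _ _ _ _ fst _ _ _ cf); exact: cvg_fst.
apply: DeriveDef; first by apply: cvgP H.
exact: cvg_lim H.
Qed.

Lemma is_derive_snd (R : realType) (V W1 W2 : normedModType R)
    (f : V -> W1 * W2) (t v : V) (df : W1 * W2) :
  is_derive t v f df -> is_derive t v (fun x => (f x).2) df.2.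
Proof.
move=> [cf <-].
have H : ((fun h => h^-1 *: (((fun x => (f x).2) \o shift t) (h *: v) -
      (f t).2)) @ 0^' --> ('D_v f t).2).
  apply: (@cvg_comp _ _ _ _ snd _ _ _ cf); exact: cvg_snd.
apply: DeriveDef; first by apply: cvgP H.
exact: cvg_lim H.
Qed.

Lemma is_derive_sumr (R : realType) (V : normedModType R) (J : finType)
    (f : J -> V -> R) (t v : V) (df : J -> R) :
  (forall j, is_derive t v (f j) (df j)) ->
  is_derive t v (fun x => \sum_j f j x) (\sum_j df j).
Proof.
move=> df_.
have -> : (fun x => \sum_j f j x) = \sum_j f j.
  by apply/funext=> x; rewrite fct_sumE.
elim/big_ind2: _ => [|g dg h dh Hg Hh|j _]; [exact: is_derive_cst| |exact: df_].
exact: is_deriveD.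
Qed.

Lemma is_derive_mulmx (R : realType) (V : normedModType R) (p q k l : nat)
    (P : 'M[R]_(k, p)) (Q : 'M[R]_(q, l)) (M : V -> 'M[R]_(p, q)) (t v : V)
    (D : 'M[R]_(p, q)) :
  is_derive t v M D -> is_derive t v (fun x => P *m M x *m Q) (P *m D *m Q).
Proof.
move/is_derive_mxP=> dM; apply/is_derive_mxP => i j.
rewrite (_ : (fun x => _) =
    (fun x => \sum_j0 \sum_j1 (P i j1 * Q j0 j) * M x j1 j0)); last first.
  apply/funext=> x; rewrite !mxE; apply: eq_bigr => a _.
  by rewrite mxE mulr_suml; apply: eq_bigr => b _; rewrite mulrAC.
have -> : (P *m D *m Q) i j = \sum_j0 \sum_j1 (P i j1 * Q j0 j) * D j1 j0.
  rewrite !mxE; apply: eq_bigr => a _.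
  by rewrite mxE mulr_suml; apply: eq_bigr => b _; rewrite mulrAC.
by apply: is_derive_sumr => a; apply: is_derive_sumr => b.
Qed.

Lemma mx_linear_differentiable (R : realType) (W : normedModType R) (p q : nat)
    (f : {linear 'M[R]_(p, q) -> W}) x : differentiable f x.
Proof.
rewrite (_ : (f : _ -> _) =
    \sum_(i < p) \sum_(j < q) fun N : 'M[R]_(p, q) => N i j *: f (delta_mx i j)).
  apply: differentiable_sum => i; apply: differentiable_sum => j.
  by apply: differentiableZl; apply: differentiable_coord.
apply/funext => N; rewrite {1}(matrix_sum_delta N) linear_sum fct_sumE.
apply: eq_bigr => i _; rewrite linear_sum fct_sumE.
by apply: eq_bigr => j _; rewrite linearZ.
Qed.

(** * The Euclidean inner product *)

Definition dot (R : realType) (m : nat) (u v : 'rV[R]_m) : R := (u *m v^T) 0 0.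

Section dot.
Context {R : realType} {m : nat}.
Implicit Types u v w : 'rV[R]_m.

Lemma euclideanE x u v : euclidean x u v = dot u v.
Proof. by rewrite /dot mxE; apply: eq_bigr => i _; rewrite mxE. Qed.

Lemma dotE u v : dot u v = \sum_i u 0 i * v 0 i.
Proof. by rewrite -(euclideanE 0). Qed.

Lemma dotC u v : dot u v = dot v u.
Proof. by rewrite !dotE; apply: eq_bigr => i _; rewrite mulrC. Qed.

Lemma dotDl u v w : dot (u + v) w = dot u w + dot v w.
Proof. by rewrite /dot mulmxDl mxE. Qed.

Lemma dotDr u v w : dot w (u + v) = dot w u + dot w v.
Proof. by rewrite dotC dotDl !(dotC w). Qed.

Lemma dotZl a u v : dot (a *: u) v = a * dot u v.
Proof. by rewrite /dot -scalemxAl mxE. Qed.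

Lemma dotZr a u v : dot u (a *: v) = a * dot u v.
Proof. by rewrite dotC dotZl dotC. Qed.

Lemma dotNl u v : dot (- u) v = - dot u v.
Proof. by rewrite -scaleN1r dotZl mulN1r. Qed.

Lemma dotNr u v : dot u (- v) = - dot u v.
Proof. by rewrite dotC dotNl dotC. Qed.

Lemma dotBl u v w : dot (u - v) w = dot u w - dot v w.
Proof. by rewrite dotDl dotNl. Qed.

Lemma dotBr u v w : dot w (u - v) = dot w u - dot w v.
Proof. by rewrite dotDr dotNr. Qed.

Lemma dot0l u : dot 0 u = 0.
Proof. by rewrite /dot mul0mx mxE. Qed.

Lemma dot0r u : dot u 0 = 0.
Proof. by rewrite dotC dot0l. Qed.

Lemma dot_suml (J : finType) (f : J -> 'rV[R]_m) u :
  dot (\sum_j f j) u = \sum_j dot (f j) u.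
Proof. by rewrite /dot mulmx_suml summxE. Qed.

Lemma dot_ge0 u : 0 <= dot u u.
Proof. by rewrite dotE; apply: sumr_ge0 => i _; rewrite -expr2 sqr_ge0. Qed.

Lemma dot_eq0 u : dot u u = 0 -> u = 0.
Proof.
rewrite dotE => /eqP; rewrite psumr_eq0; last first.
  by move=> i _; rewrite -expr2 sqr_ge0.
move=> /allP H; apply/rowP => i; rewrite mxE.
by have /implyP/(_ isT) := H i (mem_index_enum _); rewrite mulf_eq0 orbb => /eqP.
Qed.

Lemma dot_gt0 u : u != 0 -> 0 < dot u u.
Proof.
move=> u0; rewrite lt_neqAle dot_ge0 andbT eq_sym.
by apply: contra u0 => /eqP/dot_eq0/eqP.
Qed.

Lemma dot_inj u v : (forall w, dot u w = dot v w) -> u = v.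
Proof.
move=> H; apply/eqP; rewrite -subr_eq0; apply/eqP/dot_eq0.
by rewrite dotBl H subrr.
Qed.

Lemma dot_mulmx u v (A : 'M[R]_m) : dot (u *m A) v = dot u (v *m A^T).
Proof. by rewrite /dot trmx_mul trmxK mulmxA. Qed.

Lemma dot_antisym u v (A : 'M[R]_m) : A^T = - A ->
  dot (u *m A) v = - dot u (v *m A).
Proof. by move=> AT; rewrite dot_mulmx AT mulmxN dotNr. Qed.

Lemma dot_antisym0 u (A : 'M[R]_m) : A^T = - A -> dot (u *m A) u = 0.
Proof.
move=> AT; have := dot_antisym u u AT; rewrite (dotC u) => /eqP.
by rewrite -subr_eq0 opprK -mulr2n mulrn_eq0 /= => /eqP.
Qed.

Lemma is_derive_dot (V : normedModType R) (f g : V -> 'rV[R]_m) (t v : V)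
    (df dg : 'rV[R]_m) :
  is_derive t v f df -> is_derive t v g dg ->
  is_derive t v (fun x => dot (f x) (g x)) (dot df (g t) + dot (f t) dg).
Proof.
move=> /is_derive_mxP Hf /is_derive_mxP Hg.
rewrite (_ : (fun x => _) = fun x => \sum_i f x 0 i * g x 0 i); last first.
  by apply/funext => x; rewrite dotE.
rewrite (_ : _ + _ = \sum_i (f t 0 i * dg 0 i + g t 0 i * df 0 i)).
  apply: is_derive_sumr => i.
  have := Hf 0 i; have := Hg 0 i => h1 h2.
  exact: is_deriveM.
by rewrite addrC !dotE -big_split; apply: eq_bigr => i _; rewrite (mulrC (df _ _)).
Qed.

End dot.

Lemma smooth_on_differentiable (R : realType) (V W : normedModType R)
    (U : set V) (f : V -> W) x : smooth_on U f -> U x -> differentiable f x.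
Proof. by move=> H Ux; apply: (H [::]). Qed.

Lemma is_derive_line (R : realType) (V W : normedModType R) (f : V -> W)
    (x v : V) (t : R) (df : W) :
  is_derive (x + t *: v) v f df ->
  is_derive t 1 (fun s : R => f (x + s *: v)) df.
Proof.
move=> [+ <-]; rewrite /derive /derivable.
set g1 := fun h => h^-1 *: _ => cf.
have E : (fun h : R => h^-1 *: (((fun s => f (x + s *: v)) \o shift t) (h *: 1) -
      f (x + t *: v))) = g1.
  rewrite funeqE /g1 => h /=; congr (_ *: (f _ - _)).
  by rewrite [h *: 1]mulr1 scalerDl addrCA.
by apply: DeriveDef; rewrite /derive /derivable E.
Qed.

Section killing.
Context {R : realType} {m : nat}.
Implicit Types X : 'rV[R]_m -> 'rV[R]_m.

(* Integrating <D_w X, w> = 0 along straight lines makes Schwarz' theorem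
   unnecessary. *)
Lemma killing_line X x w : killing X -> dot (X (x + w)) w = dot (X x) w.
Proof.
move=> [smX kX].
have dX y : is_derive y w X ('D_w X y).
  apply/derivableP/diff_derivable; exact: smooth_on_differentiable smX _.
have X0 y : dot ('D_w X y) w = 0.
  have := kX y w w; rewrite /lie_metric !euclideanE derive_cst add0r.
  rewrite (dotC w) => /eqP; rewrite -mulr2n mulrn_eq0 /=; exact: eqP.
pose g (s : R) := dot (X (x + s *: w)) w.
have dg (s : R) : is_derive s 1 g 0.
  rewrite -(X0 (x + s *: w)) -[dot _ _]addr0 -(dot0r (X (x + s *: w))).
  apply: is_derive_dot; exact: is_derive_line.
have := is_derive_0_is_cst 0 1 dg.
by rewrite /g scale0r addr0 scale1r => ->.
Qed.

(** For Y = X - X(0), constancy along lines gives <Y(y) - Y(x), y - x> = 0. Polarization turns this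
    into <Y(x), y> = - <x, Y(y)>; the right side is linear in x, and the inner product separates
    points, so Y is linear and antisymmetric. *)
Lemma killing_affine X : killing X ->
  exists A b, A^T = - A /\ X = fun x => x *m A + b.
Proof.
move=> kX; have [Y YE] : exists Y, forall x, Y x = X x - X 0 by eexists.
have YY x y : dot (Y y - Y x) (y - x) = 0.
  by rewrite !YE opprB addrA subrK -{1}(subrKC x y) dotBl killing_line // subrr.
have Yx x : dot (Y x) x = 0.
  by have := YY 0 x; rewrite (YE 0) subrr !subr0.
have Yxy x y : dot (Y x) y = - dot x (Y y).
  have H := YY x y; rewrite dotBl !dotBr !Yx sub0r subr0 -opprD in H.
  move/eqP: H; rewrite oppr_eq0 addr_eq0 (dotC x) => /eqP ->.
  by rewrite opprK.
have Ylin : linear Y.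
  move=> a u v; apply: dot_inj => w.
  by rewrite Yxy !dotDl !dotZl !Yxy opprD mulrN.
pose YL : {linear 'rV[R]_m -> 'rV[R]_m} :=
  HB.pack Y (GRing.isLinear.Build _ _ _ _ Y Ylin).
exists (lin1_mx YL), (X 0); split; last first.
  by apply/funext => x; rewrite mul_rV_lin1 /= YE subrK.
apply/matrixP => i j; rewrite !mxE /=.
have H := Yxy (delta_mx 0 j) (delta_mx 0 i).
have E (u : 'rV[R]_m) k : dot u (delta_mx 0 k) = u 0 k.
  by rewrite /dot trmx_delta -colE mxE.
by move: H; rewrite E => ->; rewrite dotC E.
Qed.

Lemma affine_killing (A : 'M[R]_m) b : A^T = - A ->
  killing (fun x => x *m A + b).
Proof.
move=> AT; set X := fun x => _.
have dX x v : is_derive x v X (v *m A).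
  have h := is_derive_mulmx 1%:M A (is_derive_id x v).
  rewrite mul1mx in h; rewrite -[v *m A]addr0.
  have -> : X = (fun y => 1%:M *m id y *m A) + cst b.
    by apply/funext => y; rewrite -[RHS]/(1%:M *m y *m A + b) mul1mx.
  exact: is_deriveD.
have DX v : 'D_v X = fun=> v *m A.
  by apply/funext => x; apply: derive_val.
split.
- have cs (c : 'rV[R]_m) : smooth_on setT (fun _ : 'rV[R]_m => c).
    move=> vs; elim: vs c => [|v vs IH] c x _ /=; first exact: differentiable_cst.
    have -> : 'D_v (fun _ : 'rV[R]_m => c) = fun=> 0.
      by apply/funext => y; rewrite derive_cst.
    exact: IH.
  case=> [|v vs] x _ /=; last by rewrite DX; apply: cs.
  have -> : X = (mulmxr A) + cst b by [].
  apply: differentiableD; last exact: differentiable_cst.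
  exact: mx_linear_differentiable.
- move=> x u v; rewrite /lie_metric !euclideanE derive_cst add0r.
  by rewrite !derive_val dot_antisym // addNr.
Qed.

End killing.

(** * Flows and prolongations *)

(** Comparison with [C] times the exponential series at [D * |K|]. Term-wise differentiation asks
    for convergence of a series and of its first two formal derivatives, and all three fit this
    bound. *)
Lemma is_cvg_pseries_exp_bound (R : realType) (c : nat -> R) (C D K : R) :
  0 <= C -> 0 <= D -> (forall n, `|c n| <= C * (D ^+ n / n`!%:R)) ->
  cvgn (pseries c K).
Proof.
move=> C0 D0 cb; apply: normed_cvg.
apply: (@series_le_cvg _ _ (C *: exp_coeff (D * `|K|))).
- by move=> n; exact: normr_ge0.
- move=> n; apply: mulr_ge0 => //.
  by rewrite /exp_coeff /= divr_ge0 // exprn_ge0 // mulr_ge0.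
- move=> n /=; rewrite normrM normrX /exp_coeff /=.
  have -> : (C *: (fun k => (D * `|K|) ^+ k / k`!%:R)) n
      = C * (D ^+ n / n`!%:R) * `|K| ^+ n.
    rewrite -[LHS]/(C * ((D * `|K|) ^+ n / n`!%:R)) exprMn.
    by rewrite -!mulrA [`|K| ^+ n * _]mulrC.
  by rewrite ler_wpM2r ?exprn_ge0.
- by apply: is_cvg_seriesZ; apply: is_cvg_series_exp_coeff.
Qed.

Section expmx.
Context {R : realType} {m : nat} (A : 'M[R]_m).

Let mpow n := iter n (mulmxr A) 1%:M.

Let mpow_bound n i j : `|mpow n i j| <= (\sum_i \sum_j `|A i j|) ^+ n.
Proof.
set N := \sum_i _.
have N0 : 0 <= N by apply: sumr_ge0 => a _; apply: sumr_ge0.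
elim: n i j => [|n IH] i j /=.
  by rewrite mxE expr0; case: eqP; rewrite ?normr1 ?normr0.
rewrite mxE (le_trans (ler_norm_sum _ _ _)) // exprSr.
apply: (@le_trans _ _ (\sum_k N ^+ n * `|A k j|)).
  by apply: ler_sum => k _; rewrite normrM ler_wpM2r.
rewrite -mulr_sumr ler_wpM2l ?exprn_ge0 // /N.
apply: ler_sum => k _; rewrite (bigD1 j) //= lerDl; exact: sumr_ge0.
Qed.

(** The entry of A^(n-1) / n!, that is, the exponential series integrated once. It is defined also
    for singular A. *)
Let cf i j n : R := if n is k.+1 then mpow k i j / n`!%:R else 0.

(* The matrix-valued series of (exp (tau A) - 1) / A. *)
Lemma expmx_exists : exists H : R -> 'M[R]_m,
  H 0 = 0 /\ forall tau : R, is_derive tau 1 H (1%:M + H tau *m A).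
Proof.
(* The summand 1 makes N at least 1, so a power may be raised by one in a bound; this absorbs the
   index shift in [cf]. *)
pose N := 1 + \sum_i \sum_j `|A i j|.
have N1 : 1 <= N.
  by rewrite lerDl; apply: sumr_ge0 => a _; apply: sumr_ge0.
have N0 : 0 <= N by apply: le_trans N1.
have dE i j n : pseries_diffs (cf i j) n = mpow n i j / n`!%:R.
  rewrite /pseries_diffs /cf factS natrM invfM mulrCA.
  by rewrite mulVKf // pnatr_eq0.
have pb n i j : `|mpow n i j| <= N ^+ n.
  apply: le_trans (mpow_bound n i j) _.
  apply: lerXn2r; rewrite ?nnegrE //; last by rewrite /N lerDr.
  by apply: sumr_ge0 => a _; apply: sumr_ge0.
have c0 i j K : cvgn (pseries (cf i j) K).
  apply: (@is_cvg_pseries_exp_bound _ _ 1 N) => // -[|n].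
    by rewrite normr0 expr0 mul1r divr_ge0.
  rewrite mul1r normrM normfV normr_nat ler_wpM2r // (le_trans (pb _ _ _)) //.
  by rewrite exprS ler_peMl // exprn_ge0.
have c1 i j K : cvgn (pseries (pseries_diffs (cf i j)) K).
  apply: (@is_cvg_pseries_exp_bound _ _ 1 N) => // n.
  by rewrite dE mul1r normrM normfV normr_nat ler_wpM2r.
have c2 i j K : cvgn (pseries (pseries_diffs (pseries_diffs (cf i j))) K).
  apply: (@is_cvg_pseries_exp_bound _ _ N N) => // n.
  rewrite -[pseries_diffs _ n]/(n.+1%:R * pseries_diffs (cf i j) n.+1) dE.
  rewrite factS natrM invfM.
  rewrite mulrCA mulVKf ?pnatr_eq0 //.
  by rewrite normrM normfV normr_nat mulrA -exprS ler_wpM2r.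
exists (fun tau => \matrix_(i, j) limn (pseries (cf i j) tau)); split.
  apply/matrixP => i j; rewrite !mxE; apply: cvg_lim => //.
  rewrite (_ : pseries _ _ = cst 0); first exact: cvg_cst.
  apply/funext => n; rewrite /pseries /series /=.
  rewrite big1 // => -[|k] _; first by rewrite mul0r.
  by rewrite expr0n mulr0.
move=> tau; apply/is_derive_mxP => i j.
rewrite (_ : (fun x => _) = fun x => limn (pseries (cf i j) x)); last first.
  by apply/funext => x; rewrite mxE.
have -> : (1%:M + (\matrix_(i, j) limn (pseries (cf i j) tau)) *m A) i j
    = limn (pseries (pseries_diffs (cf i j)) tau).
  apply/esym/cvg_lim => //; rewrite !mxE.
  (* Shifted partial sums always contain the zeroth term. Peeled off, it is the entry of the
     identity, and the remaining terms are those of H times A. *)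
  rewrite -(cvg_shiftn 1%N).
  have E : (fun n => pseries (pseries_diffs (cf i j)) tau (n + 1)%N) =
    fun n => (i == j)%:R + \sum_k pseries (cf i k) tau (n + 1)%N * A k j.
    apply/funext => n; rewrite addn1.
    have -> : \sum_k pseries (cf i k) tau n.+1 * A k j =
      \sum_(0 <= l < n.+1) \sum_k (cf i k l * tau ^+ l) * A k j.
      rewrite exchange_big /=; apply: eq_bigr => k _.
      by rewrite /pseries /series /= mulr_suml.
    rewrite /pseries /series /= [LHS]big_nat_recl //=.
    rewrite [X in _ = _ + X]big_nat_recl //=.
    rewrite dE fact0 divr1 expr0 mulr1 [mpow 0 i j]mxE; congr (_ + _).
    rewrite [X in _ = X + _]big1 ?add0r; last by move=> k _; rewrite !mul0r.
    apply: eq_bigr => l _; rewrite dE [mpow l.+1 i j]mxE mulr_suml mulr_suml.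
    apply: eq_bigr => k _; rewrite -!mulrA; congr (_ * _).
    by rewrite mulrC -mulrA.
  rewrite E; apply: cvgD; first exact: cvg_cst.
  apply: cvg_big => [|k _]; first exact: add_continuous.
  apply: cvgMr_tmp; rewrite mxE.
  have := c0 i k tau; rewrite /= -(cvg_shiftn 1%N); exact.
apply: (@pseries_snd_diffs _ _ (`|tau| + 1)) => //.
by rewrite [ltRHS]ger0_norm ?addr_ge0 // ltrDl.
Qed.

End expmx.


Section affine_flow.
Context {R : realType} {m : nat} (A : 'M[R]_m) (H : R -> 'M[R]_m).
Hypotheses (H0 : H 0 = 0)
  (dH : forall tau : R, is_derive tau 1 H (1%:M + H tau *m A)).

(** Variation of constants: [1 + H tau *m A] is exp(tau A). The number of rows is left free so that
    one formula gives the flow on points ([p = 1]) and on jets ([p = r.+1]). *)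
Definition affine_flow (p : nat) (B : 'M[R]_(p, m)) (tau : R) (Y : 'M[R]_(p, m)) :=
  Y *m (1%:M + H tau *m A) + B *m H tau.

Lemma affine_flow0 p (B Y : 'M[R]_(p, m)) : affine_flow B 0 Y = Y.
Proof. by rewrite /affine_flow H0 mul0mx addr0 mulmx1 mulmx0 addr0. Qed.

Lemma is_derive_affine_flow p (B Y : 'M[R]_(p, m)) (tau : R) :
  is_derive tau 1 (fun s => affine_flow B s Y) (affine_flow B tau Y *m A + B).
Proof.
have -> : (fun s => affine_flow B s Y) =
    cst Y + ((fun s => Y *m H s *m A) + (fun s => B *m H s *m 1%:M)).
  apply/funext => s; rewrite -[RHS]/(Y + (Y *m H s *m A + B *m H s *m 1%:M)).
  by rewrite /affine_flow mulmxDr !mulmx1 mulmxA addrA.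
rewrite /affine_flow mulmxDr mulmx1 mulmxDl mulmxDl.
have -> : Y *m A + Y *m (H tau *m A) *m A + B *m H tau *m A + B =
  0 + (Y *m (1%:M + H tau *m A) *m A + B *m (1%:M + H tau *m A) *m 1%:M).
  rewrite add0r mulmx1 2!mulmxDr mulmxDl !mulmx1 !mulmxA -addrA.
  by rewrite (addrC _ B).
have := is_derive_mulmx Y A (dH tau); have := is_derive_mulmx B 1%:M (dH tau).
move=> h1 h2; exact: is_deriveD.
Qed.

End affine_flow.

(* The difference of two solutions of an affine antisymmetric system has
   constant norm. *)
Lemma antisym_ode_unique (R : realType) (m : nat) (A : 'M[R]_m) (b : 'rV[R]_m)
    (f g : R -> 'rV[R]_m) : A^T = - A -> f 0 = g 0 ->
  (forall t : R, is_derive t 1 f (f t *m A + b)) ->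
  (forall t : R, is_derive t 1 g (g t *m A + b)) -> f = g.
Proof.
move=> AT fg0 df dg; apply/funext => t.
pose d (s : R) := f s - g s.
have dd (s : R) : is_derive s 1 d (d s *m A).
  rewrite (_ : _ *m A = (f s *m A + b) - (g s *m A + b)).
    exact: is_deriveB.
  by rewrite mulmxBl opprD addrACA subrr addr0.
have dN (s : R) : is_derive s 1 (fun s => dot (d s) (d s)) 0.
  rewrite -[0](_ : dot (d s *m A) (d s) + dot (d s) (d s *m A) = 0).
    exact: is_derive_dot.
  by rewrite (dotC (d s)) dot_antisym0 // addr0.
have := is_derive_0_is_cst t 0 dN.
rewrite {3 4}/d fg0 subrr dot0l => /dot_eq0 /eqP.
by rewrite subr_eq0 => /eqP.
Qed.

(** * Derivatives of curves and realization of jets *)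

Section curves.
Context {R : realType} {m : nat}.
Implicit Types (s : R -> 'rV[R]_m) (I : set R).

Lemma smooth_curve_is_derive I s t k : smooth_curve I s -> I t ->
  is_derive t 1 (derive1n k s) (derive1n k.+1 s t).
Proof.
by move=> [_ sm] It; apply: DeriveDef; [exact: sm|rewrite derive1nS derive1E].
Qed.

Lemma near_derive1 (V : normedModType R) (f g : R -> V) (t : R) :
  {near t, f =1 g} -> derive1 f t = derive1 g t.
Proof. by move=> fg; rewrite !derive1E; apply: near_eq_derive. Qed.

Lemma is_derive_derive1 (V : normedModType R) (f : R -> V) (t : R) df :
  is_derive t 1 f df -> derive1 f t = df.
Proof. by move=> h; rewrite derive1E derive_val. Qed.

Lemma derive1n_affine I s t k (E : 'M[R]_m) (c : 'rV[R]_m) :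
  smooth_curve I s -> I t ->
  derive1n k ((fun x => x *m E + c) \o s) t
  = derive1n k s t *m E + (k == 0)%:R *: c.
Proof.
move=> sm; elim: k t => [|k IH] t It; first by rewrite scale1r.
rewrite derive1nS scale0r addr0.
rewrite (@near_derive1 _ _ (fun x => derive1n k s x *m E + (k == 0)%:R *: c)).
  apply: is_derive_derive1.
  have := is_derive_mulmx 1%:M E (smooth_curve_is_derive k sm It).
  rewrite mul1mx => h; rewrite -[_ *m E]addr0.
  have -> : (fun x => derive1n k s x *m E + (k == 0)%:R *: c) =
      (fun x => 1%:M *m derive1n k s x *m E) + cst ((k == 0)%:R *: c).
    by apply/funext=> x; rewrite -[RHS]/(_ *m _ *m _ + _) mul1mx.
  exact: is_deriveD.
have [opI _] := sm.
by near=> x; apply: IH; near: x; apply: open_nbhs_nbhs.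
Unshelve. all: by end_near. Qed.

Lemma is_derive_poly_row (q : 'I_m -> {poly R}) (t : R) :
  is_derive t 1 (fun x : R => \row_j (q j).[x]) (\row_j ((q j)^`()).[t]).
Proof.
apply/is_derive_mxP => i j; rewrite mxE.
have -> : (fun x : R => (\row_j0 (q j0).[x] : 'rV[R]_m) i j) = horner (q j).
  by apply/funext=> x; rewrite mxE.
exact: is_derive_poly.
Qed.

Lemma derive1n_poly_row (q : 'I_m -> {poly R}) k :
  derive1n k (fun x : R => \row_j (q j).[x]) = fun x => \row_j ((q j)^`(k)).[x].
Proof.
elim: k => [|k IH]; first by [].
rewrite derive1nS IH; apply/funext => t.
rewrite (is_derive_derive1 (is_derive_poly_row _ _)).
by apply/rowP => j; rewrite !mxE.
Qed.

Lemma derivn_comp_shift (p : {poly R}) (c : R) k :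
  (p \Po ('X - c%:P))^`(k) = p^`(k) \Po ('X - c%:P).
Proof.
elim: k => [|k IH]; first by [].
by rewrite !derivnS IH deriv_comp derivB derivX derivC subr0 mulr1.
Qed.

Lemma smooth_curve_poly_row (q : 'I_m -> {poly R}) :
  smooth_curve setT (fun x : R => \row_j (q j).[x]).
Proof.
split; first exact: openT.
move=> t _ k; rewrite derive1n_poly_row.
by case: (is_derive_poly_row (fun j => (q j)^`(k)) t).
Qed.

(** The Taylor polynomial centred at [z.1] realizes the jet. Prolonged maps, which are specified
    only on jets of curves, are thereby determined at every point. *)
Lemma jet_surj r (z : jets R m r) :
  exists s, smooth_curve setT s /\ jet r s z.1 = z.
Proof.
pose p j := \poly_(k < r.+1) (z.2 (inord k) j / k`!%:R).
exists (fun x : R => \row_j (p j \Po ('X - z.1%:P)).[x]); split.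
  exact: smooth_curve_poly_row.
case: z @p => t Z p; apply: (f_equal2 pair) => //=.
apply/matrixP => k j; rewrite mxE derive1n_poly_row mxE derivn_comp_shift.
rewrite horner_comp hornerD hornerN hornerX hornerC subrr horner_coef0.
rewrite coef_derivn addn0 coef_poly ltn_ord inord_val ffactnn.
by rewrite -[LHS]mulr_natr divfK //= pnatr_eq0 -lt0n fact_gt0.
Qed.

End curves.

(** The prolongation of a translation moves [x_0] only. *)
Definition in_row0 (R : realType) (m r : nat) (b : 'rV[R]_m) : 'M[R]_(r.+1, m) :=
  delta_mx 0 (0 : 'I_1) *m b.

Lemma row_in_row0 (R : realType) (m r : nat) (b : 'rV[R]_m) (k : 'I_r.+1) :
  row k (in_row0 r b) = (k == 0 :> nat)%:R *: b.
Proof.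
apply/rowP => j; rewrite !mxE big_ord1 !mxE eqxx andbT.
by rewrite -(inj_eq val_inj).
Qed.

Section prolongation.
Context {R : realType} {m : nat}.
Variables (A : 'M[R]_m) (b : 'rV[R]_m).
Hypothesis AT : A^T = - A.

Let X (x : 'rV[R]_m) := x *m A + b.

Definition prolonged_field r (z : jets R m r) : jets R m r :=
  (0, z.2 *m A + in_row0 r b).

Lemma affine_flow_jet (H : R -> 'M[R]_m) (I : set R) s t tau r :
  smooth_curve I s -> I t ->
  jet r (affine_flow A H b tau \o s) t
  = (t, affine_flow A H (in_row0 r b) tau (jet r s t).2).
Proof.
move=> sm It; apply: (f_equal2 pair) => //; apply/row_matrixP => k.
rewrite rowK (derive1n_affine _ _ _ sm It) /affine_flow [RHS]linearD /= 2!row_mul.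
by rewrite row_in_row0 rowK scalemxAl.
Qed.

(** Uniqueness for antisymmetric affine systems determines the flow of X, hence the prolonged flow
    on jets of curves. Every jet is one, so differentiating at tau = 0 determines the field
    everywhere. *)
Lemma prolongation_affineP r (Xr : jets R m r -> jets R m r) :
  prolongation X Xr -> Xr = @prolonged_field r.
Proof.
move=> [phi [Phi [[phi0 dphi] prol [Phi0 dPhi]]]].
have [H [H0 dH]] := expmx_exists A.
have phiE tau : phi tau = affine_flow A H b tau.
  apply/funext => x.
  suff E : phi ^~ x = (affine_flow A H b) ^~ x.
    by rewrite -[LHS]/((phi ^~ x) tau) E.
  apply: (antisym_ode_unique AT) => [|t|t]; first by rewrite phi0 affine_flow0.
    exact: dphi.
  exact: is_derive_affine_flow.
apply/funext => z; have [s [sm jz]] := jet_surj z.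
have PhiE : Phi ^~ z = fun tau => (z.1, affine_flow A H (in_row0 r b) tau z.2).
  apply/funext => tau; rewrite -jz (prol _ _ _ _ sm) // phiE.
  by rewrite (affine_flow_jet _ _ _ sm).
have := dPhi z 0; rewrite PhiE Phi0 => -[_ <-].
have h := is_derive_affine_flow dH (in_row0 r b) z.2 0.
rewrite (affine_flow0 _ H0) in h.
have := is_derive_pair (is_derive_cst (z.1 : R^o) (0:R) 1) h.
by move=> [_ ->].
Qed.

Lemma prolongation_affine r : prolongation X (@prolonged_field r).
Proof.
have [H [H0 dH]] := expmx_exists A.
exists (affine_flow A H b),
  (fun tau z => (z.1, affine_flow A H (in_row0 r b) tau z.2)).
split.
- split=> [x|x tau]; first by rewrite affine_flow0.
  exact: is_derive_affine_flow.
- by move=> tau I s t sm It; rewrite (affine_flow_jet _ _ _ sm).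
- split=> [[t Z]|[t Z] tau] /=; first by rewrite affine_flow0.
  have h1 := is_derive_cst (t : R^o) (tau : R) (1 : R).
  have h2 := is_derive_affine_flow dH (in_row0 r b) Z tau.
  exact: (is_derive_pair h1 h2).
Qed.

End prolongation.

Lemma DdistE (R : realType) (m r : nat) (z : jets R m r) :
  Ddist z = [set v | exists (A : 'M[R]_m) b, A^T = - A /\
     v = prolonged_field A b z].
Proof.
apply/seteqP; split => v /=.
- move=> [X [Xr [kX pX ->]]]; have [A [b [AT XE]]] := killing_affine kX.
  exists A, b; split=> //; rewrite XE in pX.
  by rewrite (prolongation_affineP AT pX).
- move=> [A [b [AT ->]]].
  exists (fun x => x *m A + b), (prolonged_field A b (r:=r)); split=> //.
    exact: affine_killing.
  exact: prolongation_affine.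
Qed.

(** * The dimension of the distribution *)

Lemma has_dim_uniq (R : realType) (V : vectType R) (D : set V) d d' :
  has_dim D d -> has_dim D d' -> d = d'.
Proof.
move=> [W [DW <-]] [W' [DW' <-]]; congr (\dim _).
by apply/vspaceP => v; apply/idP/idP => [/DW/DW'|/DW'/DW].
Qed.

Lemma has_dim_range (R : realType) (U V : vectType R) (f : {linear U -> V})
    (D : set V) :
  (forall v, D v <-> exists u, v = f u) -> (forall u, f u = 0 -> u = 0) ->
  has_dim D (dim U).
Proof.
move=> Df f0; exists (linfun f @: fullv)%VS; split.
  move=> v; rewrite Df; split=> [[u ->]|/memv_imgP[u _ ->]].
    by rewrite -lfunE memv_img // memvf.
  by exists u; rewrite lfunE.
rewrite limg_dim_eq ?dimvf //; apply/eqP; rewrite capfv -subv0.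
by apply/subvP => u; rewrite memv_ker lfunE memv0 => /eqP/f0/eqP.
Qed.

Lemma mul_pid_mx_sq (R : realType) (m q : nat) (B : 'M[R]_m) i j :
  (pid_mx q *m B) i j = (i < q)%:R * B i j.
Proof.
rewrite mxE (bigD1 i) //= big1 ?addr0 => [|k /negPf ki].
  by rewrite !mxE eqxx.
by rewrite !mxE -(inj_eq val_inj) eq_sym in ki *; rewrite ki mul0r.
Qed.

Lemma sum_lower_pairs m q : (q <= m)%N ->
  (2 * (\sum_(i < m | i < q) (m - i.+1)) = (2 * m - q - 1) * q)%N.
Proof.
move=> qm; rewrite (big_ord_narrow qm) /=.
elim: q qm => [|q IH] qm; first by rewrite big_ord0 !muln0.
rewrite big_ord_recr /= mulnDr IH; last exact: ltnW.
nia.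
Qed.

Section dim_Ddist.
Context {R : realType} {m : nat} (q : nat).

(** The entries above the diagonal in the first q rows: free coordinates for these rows of an
    antisymmetric matrix. *)
Let J := {p : 'I_m * 'I_m | (p.1 < p.2)%N && (p.1 < q)%N}.

Lemma card_lower_pairs : (q <= m)%N -> #|{: J}| = ((2 * m - q - 1) * q)./2.
Proof.
move=> qm; rewrite card_sig -sum1_card -(sum_lower_pairs qm) mul2n doubleK.
rewrite (eq_bigl (fun p : 'I_m * 'I_m => (p.1 < q)%N && (p.1 < p.2)%N)); last first.
  by move=> p; rewrite inE andbC.
rewrite -(pair_big_dep (fun i : 'I_m => (i < q)%N) (fun i j : 'I_m => (i < j)%N)
            (fun _ _ => 1%N)) /=.
apply: eq_bigr => i _.
by rewrite -(big_geq_mkord i.+1 m predT (fun=> 1%N)) sum_nat_const_nat muln1.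
Qed.

Definition antisym_fill (c : {ffun J -> R^o}) : 'M[R]_m :=
  \matrix_(i, j) (if insub (i, j) is Some p then c p else
                  if insub (j, i) is Some p then - c p else 0).

Lemma antisym_fill_linear : linear antisym_fill.
Proof.
move=> a c d; apply/matrixP => i j; rewrite !mxE.
case: insubP => [p _ _|_]; first by rewrite !ffunE.
case: insubP => [p _ _|_]; first by rewrite !ffunE mulrN opprD.
by rewrite mulr0 addr0.
Qed.

Lemma antisym_fillE (c : {ffun J -> R^o}) p :
  antisym_fill c (val p).1 (val p).2 = c p.
Proof. by rewrite mxE -surjective_pairing valK. Qed.

Lemma antisym_fillT c : (antisym_fill c)^T = - antisym_fill c.
Proof.
apply/matrixP => i j; rewrite !mxE.
case: insubP => [p /andP[/= ji _] _|].
  case: insubP => [p' /andP[/= ij _] _|_]; last by rewrite opprK.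
  by have := ltn_trans ij ji; rewrite ltnn.
by move=> _; case: insubP => [p _ _|_]; rewrite ?oppr0.
Qed.

(** An entry (i, j) with j < i < q mirrors (j, i), which again lies in [J]; the rows from q on are
    cut off by the projector. *)
Lemma pid_antisym_fill (B : 'M[R]_m) : B^T = - B ->
  (pid_mx q : 'M[R]_m) *m antisym_fill (finfun (fun p => B (val p).1 (val p).2))
  = (pid_mx q : 'M[R]_m) *m B.
Proof.
move=> BT; have Bij i j : B i j = - B j i.
  by have := congr1 (fun M : 'M[R]_m => M j i) BT; rewrite !mxE.
apply/matrixP => i j; rewrite !mul_pid_mx_sq; case: ltnP => iq; last by rewrite !mul0r.
congr (_ * _); rewrite mxE; case: insubP => [p _ pE|/=].
  by rewrite ffunE pE.
rewrite iq andbT -leqNgt => ji.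
case: insubP => [p _ pE|/=]; first by rewrite ffunE pE /= -Bij.
rewrite (leq_ltn_trans ji iq) andbT -leqNgt => ij.
have -> : j = i by apply/val_inj/eqP; rewrite eqn_leq ij ji.
have /eqP := Bij i i; rewrite -addr_eq0 -mulr2n mulrn_eq0 /= => /eqP //.
Qed.

End dim_Ddist.

Lemma row_row' T p q (M : 'M[T]_(p.+1, q)) k :
  row k (row' ord0 M) = row (lift ord0 k) M.
Proof. by apply/rowP => j; rewrite !mxE. Qed.

Lemma row'_in_row0 (R : realType) (m r : nat) (b : 'rV[R]_m) :
  row' ord0 (in_row0 r b) = 0.
Proof.
apply/row_matrixP => k; rewrite row_row' row_in_row0 lift0 /= scale0r.
by rewrite row0.
Qed.

Lemma eq_row0_row' (R : realType) (m r : nat) (M N : 'M[R]_(r.+1, m)) :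
  row ord0 M = row ord0 N -> row' ord0 M = row' ord0 N -> M = N.
Proof.
move=> e0 e1; apply/row_matrixP => k.
case: (unliftP ord0 k) => [j ->|-> //].
by rewrite -!row_row' e1.
Qed.

Lemma row'_mul (R : pzSemiRingType) (p q k : nat) i (M : 'M[R]_(p, q))
    (N : 'M[R]_(q, k)) :
  row' i (M *m N) = row' i M *m N.
Proof. by apply/matrixP => a b; rewrite !mxE; apply: eq_bigr => c _; rewrite mxE. Qed.

Definition lift_rows (R : realType) (m r : nat) (M : 'M[R]_(r, m)) : 'M[R]_(r.+1, m) :=
  (row' ord0 1%:M)^T *m M.

Lemma row_lift_rows (R : realType) (m r : nat) (M : 'M[R]_(r, m)) :
  (row ord0 (lift_rows M) = 0) * (row' ord0 (lift_rows M) = M).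
Proof.
split.
  by apply/rowP => j; rewrite !mxE big1 // => k _; rewrite !mxE mul0r.
apply/matrixP => k j; rewrite !mxE (bigD1 k) //= big1 ?addr0 => [|l lk].
  by rewrite !mxE eqxx mul1r.
by rewrite !mxE (inj_eq lift_inj) (negPf lk) mul0r.
Qed.

(** With Z = P E Q, where E is the rank normal form, one has Z A = P E (Q A Q^T) Q^-T, and Q A Q^T
    runs over all antisymmetric matrices as A does. Hence the values Z A are parametrized by the
    first q rows of an antisymmetric matrix, while the translation part adds m free coordinates. *)
Lemma has_dim_Ddist (R : realType) (m r : nat) (z : jets R m r) :
  has_dim (Ddist z)
    (m + ((2 * m - \rank (row' ord0 z.2) - 1) * \rank (row' ord0 z.2))./2)%N.
Proof.
set Z := row' ord0 z.2; set q := \rank Z.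
have qm : (q <= m)%N by apply: rank_leq_col.
have qr : (q <= r)%N by apply: rank_leq_row.
pose J := {p : 'I_m * 'I_m | (p.1 < p.2)%N && (p.1 < q)%N}.
pose P := col_ebase Z; pose Q := row_ebase Z.
have uP : P \in unitmx by apply: col_ebase_unit.
have uQ : Q \in unitmx by apply: row_ebase_unit.
have ZE : Z = P *m pid_mx q *m Q by rewrite mulmx_ebase.
have uQT : Q^T \in unitmx by rewrite unitmx_tr.
pose UT : vectType R := ('rV[R]_m * {ffun J -> R^o})%type.
pose f (u : 'rV[R]_m * {ffun J -> R^o}) : jets R m r :=
  (0, in_row0 r u.1 + lift_rows (P *m pid_mx q *m antisym_fill u.2 *m invmx Q^T)).
have flin : linear f.
  move=> a [b c] [b' c'] /=; apply: (f_equal2 pair) => /=.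
    by rewrite -[RHS]/(a *: (0 : R^o) + (0 : R^o)) scaler0 addr0.
  rewrite antisym_fill_linear /in_row0 /lift_rows.
  rewrite !mulmxDr !mulmxDl !mulmxDr -!scalemxAr -!scalemxAl -!scalemxAr.
  by rewrite scalerDr addrACA.
pose fL : {linear UT -> jets R m r} :=
  HB.pack f (GRing.isLinear.Build _ _ _ _ f flin).
have <- : dim UT = (m + ((2 * m - q - 1) * q)./2)%N.
  rewrite /dim /= -card_lower_pairs // dim_matrix mul1r; congr addn.
  exact: muln1.
have P0 : (pid_mx q : 'M[R]_(m, r)) *m (pid_mx q : 'M[R]_(r, m)) = pid_mx q :> 'M[R]_m.
  by rewrite mul_pid_mx minnn (minn_idPr qr).
have P1 : (pid_mx q : 'M[R]_(r, m)) *m (pid_mx q : 'M[R]_m) = pid_mx q.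
  by rewrite mul_pid_mx minnn (minn_idPr qm).
apply: (@has_dim_range R UT _ fL (Ddist z)) => [v|[b c] /= [e]].
- rewrite DdistE; split=> [[A [b [AT ->]]]|[[b c] ->]].
    pose B := Q *m A *m Q^T.
    have BT : B^T = - B.
      by rewrite !trmx_mul trmxK AT mulNmx mulmxN mulmxA.
    (* The translation parameter absorbs x_0 A, which decouples row 0 from the choice of A. *)
    exists (b + row ord0 z.2 *m A, [ffun p => B (val p).1 (val p).2]).
    apply: (f_equal2 pair) => //=; apply: eq_row0_row'.
      rewrite !linearD /= !row_in_row0 !row_lift_rows row_mul eqxx !scale1r addr0.
      by rewrite addrC.
    rewrite ![row' _ (_ + _)]linearD /= !row'_in_row0 !row_lift_rows add0r addr0.
    rewrite -{1}P1 mulmxA -[P *m _ *m _ *m _]mulmxA pid_antisym_fill // mulmxA.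
    rewrite -[P *m _ *m _]mulmxA P1 /B !mulmxA mulmxK // -ZE.
    by rewrite row'_mul.
  pose A := invmx Q *m antisym_fill c *m invmx Q^T.
  exists A, (b - row ord0 z.2 *m A); split.
    rewrite !trmx_mul antisym_fillT !trmx_inv trmxK.
    by rewrite mulNmx mulmxN mulmxA.
  apply: (f_equal2 pair) => //=; apply: eq_row0_row'.
    rewrite !linearD /= !row_in_row0 !row_lift_rows row_mul eqxx !scale1r addr0.
    by rewrite addrC subrK.
  rewrite ![row' _ (_ + _)]linearD /= !row'_in_row0 !row_lift_rows add0r addr0.
  by rewrite row'_mul -/Z {1}ZE /A !mulmxA mulmxK.
- have b0 : b = 0.
    have := congr1 (row ord0) e; rewrite linearD /= row_in_row0 row_lift_rows.
    by rewrite addr0 scale1r row0.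
  have := congr1 (row' ord0) e; rewrite linearD /= row'_in_row0 row_lift_rows.
  rewrite add0r linear0 => e1.
  have e2 : (pid_mx q : 'M[R]_m) *m antisym_fill c = 0.
    have := congr1 (fun M : 'M[R]_(r, m) =>
      (pid_mx q : 'M[R]_(m, r)) *m (invmx P *m (M *m Q^T))) e1.
    by rewrite mulmxKV // -mulmxA mulKmx // mulmxA P0 mul0mx !mulmx0.
  rewrite b0; apply: (f_equal2 pair) => //; apply/ffunP => p.
  rewrite ffunE -antisym_fillE.
  have e3 := congr1 (fun M : 'M[R]_m => M (val p).1 (val p).2) e2.
  rewrite mul_pid_mx_sq [RHS]mxE in e3.
  by have /andP[_ pq] := valP p; rewrite pq mul1r in e3.
Qed.

(** * Smooth functions *)

Lemma near_eq_differentiable (R : realType) (V W : normedModType R)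
    (f g : V -> W) x : {near x, f =1 g} -> differentiable g x -> differentiable f x.
Proof.
move=> fg dg; have fgx : f x = g x := nbhs_singleton fg.
have E : f \o shift x = cst (f x) + 'd g x +o_ 0 id.
  apply/eqaddoP => _/posnumP[e].
  have := diff_locally dg => /eqaddoP /(_ e%:num) /(_ [gt0 of e%:num]).
  apply: filter_app; rewrite near_simpl; near=> h.
  rewrite -![(_ + _ : _ -> _) _]/(_ + _) -![(- _ : _ -> _) _]/(- _) /=.
  rewrite fgx; suff -> : f (h + x) = g (h + x) by [].
  near: h.
  have : \forall y \near x, f y = g y by [].
  by rewrite (near_shift 0) /= subr0.
apply/diff_locallyP; rewrite (diff_unique _ E); last exact: diff_continuous.
by split=> //; exact: diff_continuous.
Unshelve. all: by end_near. Qed.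

Section smooth_closure.
Context {R : realType} {V : normedModType R} (U : set V).
Hypothesis opU : open U.
Implicit Types f g : V -> R.

(* Closed under differentiation, which makes all its members smooth. *)
Inductive smooth_expr : (V -> R) -> Prop :=
| smooth_expr_atom f : smooth_on U (f : V -> R^o) -> smooth_expr f
| smooth_exprD f g : smooth_expr f -> smooth_expr g ->
    smooth_expr (fun x => f x + g x)
| smooth_exprM f g : smooth_expr f -> smooth_expr g ->
    smooth_expr (fun x => f x * g x)
| smooth_exprV f : smooth_expr f -> (forall x, U x -> f x != 0) ->
    smooth_expr (fun x => (f x)^-1)
| smooth_expr_sqrt f : smooth_expr f -> (forall x, U x -> 0 < f x) ->
    smooth_expr (fun x => Num.sqrt (f x)).

Lemma smooth_on_derive (W : normedModType R) (f : V -> W) v :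
  smooth_on U f -> smooth_on U (fun x => 'D_v f x).
Proof. by move=> sf vs; apply: (sf (v :: vs)). Qed.

Lemma smooth_on_cst (W : normedModType R) (c : W) : smooth_on U (fun _ : V => c).
Proof.
move=> vs; elim: vs c => [|v vs IH] c x Ux /=; first exact: differentiable_cst.
have -> : 'D_v (fun _ : V => c) = fun=> 0.
  by apply/funext => y; rewrite derive_cst.
exact: IH.
Qed.

Lemma smooth_on_affine (W : normedModType R) (f : V -> W) (df : V -> W) :
  (forall x, differentiable f x) -> (forall v x, 'D_v f x = df v) ->
  smooth_on U f.
Proof.
move=> cf Df [|v vs] x Ux //=.
have -> : 'D_v f = fun=> df v by apply/funext => y; rewrite Df.
exact: smooth_on_cst.
Qed.

Lemma smooth_expr_cst c : smooth_expr (fun=> c).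
Proof. exact/smooth_expr_atom/smooth_on_cst. Qed.

(** Derivatives are described on U alone, since only there are the inverted functions known to be
    nonzero and the radicands positive. *)
Lemma smooth_expr_derive f : smooth_expr f ->
  (forall x, U x -> differentiable f x) /\
  forall v, exists2 g, smooth_expr g & forall x, U x -> 'D_v f x = g x.
Proof.
elim=> {f} [f sf|f g _ [df Df] _ [dg Dg]|f g sf [df Df] sg [dg Dg]|f sf [df Df] f0
  |f sf [df Df] f0].
- split=> [x Ux|v]; first exact: smooth_on_differentiable sf Ux.
  exists (fun x => 'D_v (f : V -> R^o) x) => //.
  exact/smooth_expr_atom/smooth_on_derive.
- split=> [x Ux|v]; first by apply: differentiableD; [exact: df|exact: dg].
  have [f' sf' Ef] := Df v; have [g' sg' Eg] := Dg v.
  exists (fun x => f' x + g' x) => [|x Ux]; first exact: smooth_exprD.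
  rewrite -Ef // -Eg //; apply: deriveD; apply: diff_derivable; [exact: df|exact: dg].
- split=> [x Ux|v]; first by apply: differentiableM; [exact: df|exact: dg].
  have [f' sf' Ef] := Df v; have [g' sg' Eg] := Dg v.
  exists (fun x => f x * g' x + g x * f' x) => [|x Ux].
    by apply: smooth_exprD; apply: smooth_exprM.
  rewrite -Ef // -Eg //; apply: deriveM; apply: diff_derivable; [exact: df|exact: dg].
- split=> [x Ux|v]; first by apply: differentiableV; [exact: df|exact: f0].
  have [f' sf' Ef] := Df v.
  exists (fun x => - 1 * ((f x)^-1 * (f x)^-1) * f' x) => [|x Ux].
    do !apply: smooth_exprM => //; try exact: smooth_exprV.
    exact: smooth_expr_cst.
  rewrite -Ef // deriveV; [|exact: f0|exact/diff_derivable/df].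
  by rewrite mulN1r expr2 invfM.
- have dsq x : U x -> differentiable (Num.sqrt : R -> R) (f x).
    by move=> Ux; apply/derivable1_diffP; case: (is_derive1_sqrt (f0 _ Ux)).
  split=> [x Ux|v]; first by apply: differentiable_comp; [exact: df|exact: dsq].
  have [f' sf' Ef] := Df v.
  exists (fun x => (2 * Num.sqrt (f x))^-1 * f' x) => [|x Ux].
    apply: smooth_exprM => //; apply: smooth_exprV.
      by apply: smooth_exprM; [exact: smooth_expr_cst|exact: smooth_expr_sqrt].
    move=> x Ux; rewrite mulf_neq0 ?pnatr_eq0 //.
    by rewrite gt_eqF // sqrtr_gt0 f0.
  rewrite -Ef // deriveE; last by apply: differentiable_comp; [exact: df|exact: dsq].
  rewrite diff_comp; [|exact: df|exact: dsq].
  rewrite /= diff1E; last exact: dsq.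
  rewrite -deriveE; last exact: df.
  have := is_derive1_sqrt (f0 _ Ux) => -[_ h].
  by rewrite derive1E h [LHS]mulrC.
Qed.

(** The induction lets both functions vary: a derivative merely agrees on U with another member of
    the class, and openness of U carries such an agreement over to the next derivative. *)
Lemma smooth_expr_smooth f g : smooth_expr f -> (forall x, U x -> g x = f x) ->
  smooth_on U (g : V -> R^o).
Proof.
move=> sf gf vs; elim: vs f sf g gf => [|v vs IH] f sf g gf x Ux /=;
  have [df Df] := smooth_expr_derive sf.
  apply: near_eq_differentiable (df _ Ux).
  by near=> y; apply: gf; near: y; apply: open_nbhs_nbhs.
have [f' sf' Ef] := Df v.
apply: (IH f') => // y Uy.
rewrite -Ef //; apply: near_eq_derive.
by near=> u; apply: gf; near: u; apply: open_nbhs_nbhs.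
Unshelve. all: by end_near. Qed.

Lemma smooth_expr_sum (J : Type) (r : seq J) (P : pred J) (f : J -> V -> R) :
  (forall j, smooth_expr (f j)) -> smooth_expr (fun x => \sum_(j <- r | P j) f j x).
Proof.
move=> sf; elim: r => [|j r IH].
  rewrite (_ : (fun x => _) = fun=> 0); first exact: smooth_expr_cst.
  by apply/funext => x; rewrite big_nil.
rewrite (_ : (fun x => _) = if P j then (fun x => f j x + \sum_(j <- r | P j) f j x)
   else fun x => \sum_(j <- r | P j) f j x).
  by case: (P j) => //; apply: smooth_exprD.
by apply/funext => x; rewrite big_cons; case: (P j).
Qed.

Lemma smooth_expr_prod (J : Type) (r : seq J) (P : pred J) (f : J -> V -> R) :
  (forall j, smooth_expr (f j)) -> smooth_expr (fun x => \prod_(j <- r | P j) f j x).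
Proof.
move=> sf; elim: r => [|j r IH].
  rewrite (_ : (fun x => _) = fun=> 1); first exact: smooth_expr_cst.
  by apply/funext => x; rewrite big_nil.
rewrite (_ : (fun x => _) = if P j then (fun x => f j x * \prod_(j <- r | P j) f j x)
   else fun x => \prod_(j <- r | P j) f j x).
  by case: (P j) => //; apply: smooth_exprM.
by apply/funext => x; rewrite big_cons; case: (P j).
Qed.

Lemma smooth_expr_det n (M : V -> 'M[R]_n) :
  (forall i j, smooth_expr (fun x => M x i j)) -> smooth_expr (fun x => \det (M x)).
Proof.
move=> sM; apply: smooth_expr_sum => s; apply: smooth_exprM.
  exact: smooth_expr_cst.
by apply: smooth_expr_prod => i; apply: sM.
Qed.

End smooth_closure.

Section jet_coordinates.
Context {R : realType} {m r : nat} (U : set (jets R m r)).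

Lemma is_derive_jet_coord (z v : jets R m r) k i :
  is_derive z v (fun w : jets R m r => w.2 k i : R) (v.2 k i).
Proof. by have /is_derive_snd/is_derive_mxP := is_derive_id z v; apply. Qed.

Lemma is_derive_jet_time (z v : jets R m r) :
  is_derive z v (fun w : jets R m r => w.1 : R^o) v.1.
Proof. by have /is_derive_fst := is_derive_id z v. Qed.

Lemma smooth_jet_coord k i : smooth_expr U (fun w : jets R m r => w.2 k i).
Proof.
apply: smooth_expr_atom; apply: (@smooth_on_affine _ _ U R^o _ (fun v => v.2 k i : R^o)).
- move=> z; apply: (@differentiable_comp _ _ _ _ (snd : jets R m r -> _)
    (fun M : 'M[R]_(r.+1, m) => M k i : R^o)); last exact: differentiable_coord.
  by apply: linear_differentiable => x; exact: cvg_snd.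
- by move=> v z; have := is_derive_jet_coord z v k i => -[_ ->].
Qed.

Lemma smooth_jet_time : smooth_expr U (fun w : jets R m r => w.1).
Proof.
apply: smooth_expr_atom; apply: (@smooth_on_affine _ _ U R^o _ (fun v => v.1 : R^o)).
- by move=> z; apply: linear_differentiable => x; exact: cvg_fst.
- by move=> v z; have := is_derive_jet_time z v => -[_ ->].
Qed.

End jet_coordinates.

(** * Generic rank of a jet and the number of invariants *)

Lemma smooth_expr_continuous (R : realType) (V : normedModType R) (f : V -> R) :
  smooth_expr setT f -> continuous (f : V -> R^o).
Proof.
move=> sf x; apply: differentiable_continuous.
by have [df _] := smooth_expr_derive sf; apply: df.
Qed.

(** Fixed P and Q turn a lower bound on the rank into the nonvanishing of a single determinant,
    which is an open condition on M. *)
Lemma rank_ge_certificate (F : fieldType) (p q k : nat) (M : 'M[F]_(p, q)) :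
  (k <= \rank M)%N -> exists P Q, P *m M *m Q = 1%:M :> 'M[F]_k.
Proof.
move=> kM; exists (pid_mx k *m invmx (col_ebase M)), (invmx (row_ebase M) *m pid_mx k).
rewrite -{2}(mulmx_ebase M) !mulmxA mulmxKV ?col_ebase_unit //.
rewrite mulmxK ?row_ebase_unit // !mul_pid_mx.
have kp : (k <= p)%N := leq_trans kM (rank_leq_row M).
have kq : (k <= q)%N := leq_trans kM (rank_leq_col M).
rewrite (minn_idPl kM) (minn_idPr kp) minnn (minn_idPr kq).
by rewrite pid_mx_1.
Qed.

Lemma near_rank_rows (R : realType) (m r k : nat) (z : jets R m r) :
  (k <= \rank (row' ord0 z.2))%N ->
  \forall w \near z, (k <= \rank (row' ord0 w.2))%N.
Proof.
move=> /rank_ge_certificate[P [Q PQ]].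
pose f (w : jets R m r) := \det (P *m row' ord0 w.2 *m Q).
have cf : continuous (f : _ -> R^o).
  apply: smooth_expr_continuous; apply: smooth_expr_det => i j.
  rewrite (_ : (fun w => _) = fun w : jets R m r =>
      \sum_b (\sum_a P i a * w.2 (lift ord0 a) b) * Q b j).
    apply: smooth_expr_sum => b; apply: smooth_exprM; last exact: smooth_expr_cst.
    apply: smooth_expr_sum => a; apply: smooth_exprM; first exact: smooth_expr_cst.
    exact: smooth_jet_coord.
  apply/funext => w; rewrite !mxE; apply: eq_bigr => b _; rewrite mxE.
  by congr (_ * _); apply: eq_bigr => a _; rewrite mxE.
have fz : f z != 0 by rewrite /f PQ det1 oner_neq0.
near=> w.
have : f w != 0 by near: w; exact: cvgr_neq0 (cf z) fz.
rewrite -unitfE -unitmxE => /mxrank_unit <-.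
by apply: leq_trans (mxrankM_maxl _ _) _; exact: mxrankM_maxr.
Unshelve. all: by end_near. Qed.

(** The points d / (n+2) are distinct and lie strictly between 0 and d; [size p] of them are too
    many to be all roots. *)
Lemma poly_small_nonroot (R : realType) (p : {poly R}) (d : R) :
  p != 0 -> 0 < d -> exists2 e, 0 < e < d & ~~ root p e.
Proof.
move=> p0 d0; pose e (n : nat) := d / n.+2%:R.
have e_in n : 0 < e n < d.
  rewrite divr_gt0 //= /e ltr_pdivrMr // ltr_pMr //.
  by rewrite ltr1n.
have [/allP H|/allPn[x /mapP[n _ ->] xr]] :=
  boolP (all (root p) (map e (iota 0 (size p)))).
  have u : uniq (map e (iota 0 (size p))).
    rewrite map_inj_uniq ?iota_uniq // => a b /(mulfI (lt0r_neq0 d0))/invr_inj/eqP.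
    by rewrite eqr_nat => /eqP[].
  have := max_poly_roots p0 _ u; rewrite size_map size_iota ltnn.
  by move/(_ (introT allP H)).
by exists (e n).
Qed.

(** Perturb by e times the rank-k normal form. A k by k block N then becomes N + e, which is
    singular only when e is an eigenvalue of -N, so arbitrarily small good e exist. *)
Lemma dense_rank_rows (R : realType) (m r k : nat) : (k <= r)%N -> (k <= m)%N ->
  dense [set z : jets R m r | (k <= \rank (row' ord0 z.2))%N].
Proof.
move=> kr km O [z Oz] opO.
pose u : jets R m r := (0, lift_rows (pid_mx k)).
have cu : (fun e : R => z + e *: u) @ 0 --> z.
  rewrite -[X in _ --> X]addr0 -(scale0r u).
  by apply: cvgD; [exact: cvg_cst|exact: scalel_continuous].
have /cu : nbhs z O by exact: open_nbhs_nbhs.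
move=> /nbhs_ballP[d /= d0 dO].
pose P : 'M[R]_(k, r) := pid_mx k; pose Q : 'M[R]_(m, k) := pid_mx k.
pose N := P *m row' ord0 z.2 *m Q.
have [e /andP[e0 ed] er] := poly_small_nonroot (monic_neq0 (char_poly_monic (- N))) d0.
exists (z + e *: u); split.
  by apply: dO; rewrite /ball /= sub0r normrN gtr0_norm.
rewrite /= linearD linearZ /= row_lift_rows.
set M := _ + _.
have PMQ : P *m M *m Q = N + e%:M.
  rewrite mulmxDr mulmxDl -scalemxAr -scalemxAl !mul_pid_mx.
  by rewrite !minnn (minn_idPr kr) !minnn (minn_idPr km) pid_mx_1 scalemx1.
have : \rank (N + e%:M)%R = k.
  move: er; rewrite -eigenvalue_root_char /eigenvalue /eigenspace.
  by rewrite negbK kermx_eq0 -opprD /row_free mxrank_opp => /eqP.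
move=> <-; rewrite -PMQ.
by apply: leq_trans (mxrankM_maxl _ _) _; exact: mxrankM_maxr.
Qed.

(** At a regular point the dimension is constant nearby, and every neighbourhood contains a jet of
    rank at least k; so the constant can only be [d]. *)
Lemma is_Nr_generic (R : realType) (m r k d : nat) :
  (k <= r)%N -> (k <= m)%N ->
  (forall z : jets R m r, (k <= \rank (row' ord0 z.2))%N -> has_dim (Ddist z) d) ->
  is_Nr R m r (m * r.+1 + 1 - d)%N.
Proof.
move=> kr km dimD; split.
  move=> O O0 opO; have [w [Ow kw]] := dense_rank_rows kr km O0 opO.
  exists w; split=> //; exists d.
  by have := near_rank_rows kw; apply: filterS => v; exact: dimD.
move=> z d' [d'' Hz] dz.
have -> := has_dim_uniq dz (nbhs_singleton Hz).
have := Hz; rewrite -nbhs_nearE nbhsE => -[B [opB Bz] BH].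
have [w [Ow kw]] := dense_rank_rows kr km (ex_intro _ z Bz) opB.
by rewrite (has_dim_uniq (BH _ Ow) (dimD _ kw)).
Qed.

Lemma has_dim_Ddist_small (R : realType) (m r : nat) (z : jets R m r) :
  (r <= \rank (row' ord0 z.2))%N ->
  has_dim (Ddist z) (m + ((2 * m - r - 1) * r)./2)%N.
Proof.
move=> h; have := has_dim_Ddist z.
by have -> : \rank (row' ord0 z.2) = r by apply/anti_leq; rewrite h rank_leq_row.
Qed.

(** The first m-1 rows of an antisymmetric matrix determine the last one, so ranks m-1 and m give
    the same count. This is why Frenet jets already have the maximal dimension. *)
Lemma half_pairs_top m q : (m.-1 <= q)%N -> (q <= m)%N ->
  ((2 * m - q - 1) * q)%N = (m * m.-1)%N.
Proof.
move=> h qm; have [->|->] : q = m \/ q = m.-1 by lia.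
  by case: m {h qm} => // m; nia.
by case: m {h qm} => // m; nia.
Qed.

Lemma has_dim_Ddist_large (R : realType) (m r : nat) (z : jets R m r) :
  (m.-1 <= \rank (row' ord0 z.2))%N -> has_dim (Ddist z) (m + 'C(m, 2))%N.
Proof.
move=> h; have := has_dim_Ddist z.
by rewrite bin2 (half_pairs_top h) // rank_leq_col.
Qed.

Lemma rows_pid_mx (R : pzRingType) (n1 n2 m : nat) (f : nat -> 'rV[R]_m) :
  (n1 <= n2)%N ->
  \matrix_(k < n1) f k = (pid_mx n1 : 'M[R]_(n1, n2)) *m \matrix_(k < n2) f k.
Proof.
move=> n12; apply/row_matrixP => k; rewrite rowK row_mul.
rewrite (_ : row k (pid_mx n1) = delta_mx 0 (widen_ord n12 k)).
  by rewrite -rowE rowK.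
apply/rowP => j; rewrite !mxE eqxx ltn_ord andbT -(inj_eq val_inj) /=.
by rewrite eq_sym.
Qed.

Lemma row'_jet (R : realType) (m r : nat) (s : R -> 'rV[R]_m) t :
  row' ord0 (jet r s t).2 = \matrix_(k < r) derive1n k.+1 s t.
Proof. by apply/row_matrixP => k; rewrite row_row' !rowK lift0. Qed.

Lemma frenet_jetsP (R : realType) (m : nat) (I : set R) s (t : R) :
  smooth_curve I s -> I t ->
  frenet_jets R m (jet m.-1 s t) <-> frenet_at s t.
Proof.
move=> sm It; split=> [[I' [s' [t' [_ _ fr e]]]]|fr]; last by exists I, s, t.
by rewrite /frenet_at -row'_jet e row'_jet.
Qed.

Section frenet_dim.
Context {R : realType} {m : nat} (s : R -> 'rV[R]_m) (t : R).
Hypothesis fr : frenet_at s t.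

Lemma frenet_rank_small r : (r <= m.-1)%N -> (r <= \rank (row' ord0 (jet r s t).2))%N.
Proof.
move=> rm; rewrite row'_jet (@rows_pid_mx _ _ _ _ (fun k => derive1n k.+1 s t) rm).
by rewrite mxrankMfree // rank_pid_mx.
Qed.

Lemma frenet_rank_large r : (m.-1 <= r)%N ->
  (m.-1 <= \rank (row' ord0 (jet r s t).2))%N.
Proof.
move=> rm; have /eqP {1}<- := fr.
rewrite (@rows_pid_mx _ _ _ _ (fun k => derive1n k.+1 s t) rm).
by rewrite row'_jet mxrankM_maxr.
Qed.

End frenet_dim.

Lemma is_Nr_small (R : realType) (m r : nat) : (1 <= r <= m.-1)%N ->
  is_Nr R m r (1 + 'C(r.+1, 2))%N.
Proof.
move=> /andP[r1 rm].
have -> : (1 + 'C(r.+1, 2) = m * r.+1 + 1 - (m + ((2 * m - r - 1) * r)./2))%N.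
  rewrite bin2 /=.
  have : (((2 * m - r - 1) * r)./2).*2 = ((2 * m - r - 1) * r)%N.
    rewrite -[RHS]odd_double_half oddM oddB ?oddB; try lia.
  have : ((r.+1 * r)./2).*2 = (r.+1 * r)%N.
    by rewrite -[RHS]odd_double_half oddM /= andNb.
  nia.
apply: (@is_Nr_generic _ _ _ r) => //; first by apply: leq_trans rm (leq_pred _).
exact: has_dim_Ddist_small.
Qed.

Lemma is_Nr_large (R : realType) (m r : nat) : (0 < m)%N -> (m <= r)%N ->
  is_Nr R m r (1 + (m * (2 * r - m + 1))./2)%N.
Proof.
move=> m0 rm.
have -> : (1 + (m * (2 * r - m + 1))./2 = m * r.+1 + 1 - (m + 'C(m, 2)))%N.
  rewrite bin2.
  have : ((m * m.-1)./2).*2 = (m * m.-1)%N.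
    by rewrite -[RHS]odd_double_half oddM -subn1 oddB // addbT andbN.
  have : ((m * (2 * r - m + 1))./2).*2 = (m * (2 * r - m + 1))%N.
    rewrite -[RHS]odd_double_half oddM oddD oddB ?mul2n ?odd_double /=; last lia.
    by rewrite addbT andbN.
  case: m m0 rm => // m _ rm; nia.
apply: (@is_Nr_generic _ _ _ m.-1) => //; first by lia.
  by lia.
by move=> z; exact: has_dim_Ddist_large.
Qed.

(** * Curvatures and Gram determinants *)

Section orthonormal_basis.
Context {R : realType} {m : nat} (e : nat -> 'rV[R]_m).
Hypothesis one : forall i j, (i < m)%N -> (j < m)%N -> dot (e i) (e j) = (i == j)%:R.

Lemma onb_mul_tr : (\matrix_(i < m) e i) *m (\matrix_(i < m) e i)^T = 1%:M.
Proof.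
apply/matrixP => i j; rewrite !mxE -(inj_eq val_inj) /= -(one (ltn_ord i) (ltn_ord j)).
by rewrite dotE; apply: eq_bigr => k _; rewrite !mxE.
Qed.

Lemma onb_expand v : v = \sum_(l < m) dot v (e l) *: e l.
Proof.
rewrite -{1}[v]mulmx1 -(mulmx1C onb_mul_tr) mulmxA mulmx_sum_row.
apply: eq_bigr => l _; rewrite rowK; congr (_ *: _).
by rewrite dotE mxE; apply: eq_bigr => k _; rewrite !mxE.
Qed.

Lemma onb_det_sqr : \det (\matrix_(i < m) e i) ^+ 2 = 1.
Proof. by rewrite expr2 -{2}det_tr -det_mulmx onb_mul_tr det1. Qed.

Variables (b : nat -> 'rV[R]_m) (n : nat).
Hypotheses (nm : (n <= m)%N)
  (trig : forall i l, (i < n)%N -> (l < m)%N -> (i < l)%N -> dot (b i) (e l) = 0).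

Let L : 'M[R]_n := \matrix_(i < n, l < n) dot (b i) (e l).

Lemma trig_mul : \matrix_(i < n) b i = L *m \matrix_(i < n) e i.
Proof.
apply/row_matrixP => i; rewrite row_mul rowK {1}[b i]onb_expand.
rewrite mulmx_sum_row (bigID (fun l : 'I_m => (l < n)%N)) /= [X in _ + X]big1 ?addr0.
  rewrite (big_ord_narrow nm); apply: eq_bigr => l _.
  by rewrite rowK !mxE.
move=> l; rewrite -leqNgt => nl.
by rewrite trig ?scale0r // (leq_trans _ nl).
Qed.

Lemma trig_det : \det L = \prod_(i < n) dot (b i) (e i).
Proof.
rewrite det_trig; first by apply: eq_bigr => i _; rewrite mxE.
apply/is_trig_mxP => i l il; rewrite mxE trig //.
exact: leq_trans (ltn_ord l) nm.
Qed.

Lemma trig_gram : \det ((\matrix_(i < n) b i) *m (\matrix_(i < n) b i)^T)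
  = (\prod_(i < n) dot (b i) (e i)) ^+ 2.
Proof.
rewrite trig_mul trmx_mul mulmxA -[L *m _ *m _]mulmxA.
have -> : (\matrix_(i < n) e i) *m (\matrix_(i < n) e i)^T = 1%:M.
  apply/matrixP => i j; rewrite !mxE -(inj_eq val_inj) /=.
  rewrite -one ?(leq_trans (ltn_ord _) nm) //.
  by rewrite dotE; apply: eq_bigr => k _; rewrite !mxE.
by rewrite mulmx1 det_mulmx det_tr trig_det expr2.
Qed.

End orthonormal_basis.

(* Signed for n = m; meaningless for n > m. *)
Definition vol (R : realType) (m n : nat) (b : nat -> 'rV[R]_m) : R :=
  if (n < m)%N then Num.sqrt (\det ((\matrix_(i < n) b i) *m (\matrix_(i < n) b i)^T))
  else \det (\matrix_(i < m) b i).

(* Here b k stands for derive1n k.+1 s t. With c_k = <s^(k), X_k>, vol k is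
   c_1 ... c_k, so curv i is c_{i+1} / (c_1 c_i). *)
Definition curv (R : realType) (m i : nat) (b : nat -> 'rV[R]_m) : R :=
  if i is 0 then vol 1 b
  else vol i.+1 b * vol i.-1 b * (vol 1 b * (vol i b * vol i b))^-1.

(** Expanding b in e gives a triangular transition matrix with diagonal <b_i, e_i>. For n < m all
    factors are positive and the root of the squared product is the product; for n = m the last
    factor may have any sign, which the determinant retains because e is positively oriented. *)
Lemma vol_prod (R : realType) (m n : nat) (b e : nat -> 'rV[R]_m) :
  (forall i j, (i < m)%N -> (j < m)%N -> dot (e i) (e j) = (i == j)%:R) ->
  0 < \det (\matrix_(i < m) e i) ->
  (forall i l, (i < l)%N -> (l < m)%N -> dot (b i) (e l) = 0) ->
  (forall i, (i < m.-1)%N -> 0 < dot (b i) (e i)) ->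
  (n <= m)%N -> vol n b = \prod_(i < n) dot (b i) (e i).
Proof.
move=> one dete trig pos nm; rewrite /vol; case: ltnP => [nm'|mn].
  rewrite (trig_gram one nm); last by move=> i l _ lm il; exact: trig.
  rewrite sqrtr_sqr ger0_norm //; apply: prodr_ge0 => i _.
  by apply/ltW/pos/(leq_trans (ltn_ord i)); rewrite -ltnS prednK //; lia.
have -> : n = m by apply/anti_leq; rewrite nm mn.
rewrite (trig_mul one (leqnn m)) => [|i l _ lm il]; last exact: trig.
rewrite det_mulmx (trig_det (leqnn m)) => [|i l _ lm il]; last exact: trig.
suff -> : \det (\matrix_(i < m) e i) = 1 by rewrite mulr1.
have /eqP := onb_det_sqr one; rewrite sqrf_eq1 => /orP[/eqP //|/eqP d1].
by move: dete; rewrite d1 oppr_gt0 ltr10.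
Qed.

Section frenet_unique.
Context {R : realType} {m : nat}.
Variables (I : set R) (s : R -> 'rV[R]_m) (X : nat -> R -> 'rV[R]_m)
  (kappa : nat -> R -> R).
Hypothesis fd : frenet_data I s X kappa.

Let x k t := derive1n k s t.

Let sm : smooth_curve I s. Proof. by case: fd => -[]. Qed.

Let smX j : (0 < j <= m)%N -> smooth_curve I (X j).
Proof. by case: fd => _ [+ _] _ _ _; apply. Qed.

Let one t i j : I t -> (0 < i <= m)%N -> (0 < j <= m)%N ->
  dot (X i t) (X j t) = (i == j)%:R.
Proof.
move=> It im jm; case: fd => _ _ /(_ t It)[+ _ _] _ _ => /(_ i j im jm).
by rewrite euclideanE.
Qed.

Let k_gt0 t j : I t -> (j < m.-1)%N -> 0 < kappa j t.
Proof. by move=> It jm; case: fd => _ _ _ /(_ t It j jm). Qed.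

(** The Frenet equations for 2 <= j < m and for j = m in one form; the factor kappa_0 converts the
    derivative along X_1 into the one in t. *)
Let dX t j : I t -> (2 <= j <= m)%N ->
  is_derive t 1 (X j) (kappa 0 t *: (- kappa j.-1 t *: X j.-1 t +
    (if (j < m)%N then kappa j t *: X j.+1 t else 0))).
Proof.
move=> It /andP[j2 jm].
have k0 : kappa 0 t != 0 by rewrite gt_eqF // k_gt0 //; lia.
have -> : kappa 0 t *: (- kappa j.-1 t *: X j.-1 t +
    (if (j < m)%N then kappa j t *: X j.+1 t else 0)) = derive1n 1 (X j) t.
  case: fd => _ _ _ _ /(_ t It)[_ _ e2 e3].
  apply: (canLR (scalerKV k0)); case: ltnP => jm'.
    by rewrite derive1n1 e2 ?opprK //; lia.
  have -> : j = m by lia.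
  by rewrite derive1n1 e3 ?addr0 //; lia.
have smj : smooth_curve I (X j) by apply: smX; lia.
exact: (smooth_curve_is_derive 0 smj).
Qed.

(** Differentiate <x_k, X_j> = 0 for j > k+1: the derivative of X_j involves only X_{j-1} and
    X_{j+1}, both still orthogonal to x_k, so <x_{k+1}, X_j> = 0. *)
Let trigX k : (0 < k)%N -> forall j t, I t -> (k < j <= m)%N -> dot (x k t) (X j t) = 0.
Proof.
elim: k => // -[_ _|k IH _] j t It kj.
  case: fd => _ _ _ _ /(_ t It)[+ _ _ _]; rewrite /x derive1n1 => ->.
  rewrite dotZl one //; try lia.
  by rewrite (_ : 1 == j = false) ?mulr0 //; lia.
have [opI _] := sm.
have d1 : is_derive t 1 (fun u => dot (x k.+1 u) (X j u)) 0.
  apply: (@near_eq_is_derive _ _ _ (fun=> 0 : R)).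
  near=> u; rewrite (IH _ j u) //; last lia.
  by near: u; apply: open_nbhs_nbhs.
have jm : (2 <= j <= m)%N by lia.
have [_ d2] := is_derive_dot (smooth_curve_is_derive k.+1 sm It) (dX It jm).
have z1 : dot (x k.+1 t) (X j.-1 t) = 0 by apply: IH => //; lia.
have z2 : dot (x k.+1 t) (if (j < m)%N then kappa j t *: X j.+1 t else 0) = 0.
  case: (ltnP j m) => jm'; last by rewrite dot0r.
  by rewrite dotZr IH ?mulr0 //; lia.
move: d1 => -[_]; rewrite /x d2 dotZr dotDr dotZr z1 z2.
by rewrite mulr0 addr0 mulr0 addr0.
Unshelve. all: by end_near. Qed.

Let c k t := dot (x k t) (X k t).

Let c1 t : I t -> (0 < m)%N -> c 1 t = kappa 0 t.
Proof.
move=> It m0; case: fd => _ _ _ _ /(_ t It)[+ _ _ _]; rewrite /c /x derive1n1 => ->.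
by rewrite dotZl one // ?mulr1 //; lia.
Qed.

(** Differentiate <x_k, X_{k+1}> = 0: of the derivative of X_{k+1} only the component - kappa_0
    kappa_k along X_k contributes. *)
Let cS k t : I t -> (0 < k < m)%N -> c k.+1 t = kappa 0 t * kappa k t * c k t.
Proof.
move=> It km; have [opI _] := sm.
have d1 : is_derive t 1 (fun u => dot (x k u) (X k.+1 u)) 0.
  apply: (@near_eq_is_derive _ _ _ (fun=> 0 : R)).
  near=> u; rewrite trigX //; [lia| |lia].
  by near: u; apply: open_nbhs_nbhs.
have jm : (2 <= k.+1 <= m)%N by lia.
have [_ d2] := is_derive_dot (smooth_curve_is_derive k sm It) (dX It jm).
have z2 : dot (x k t) (if (k.+1 < m)%N then kappa k.+1 t *: X k.+2 t else 0) = 0.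
  case: (ltnP k.+1 m) => jm'; last by rewrite dot0r.
  by rewrite dotZr trigX ?mulr0 //; lia.
move: d1 => -[_]; rewrite d2 dotZr dotDr dotZr z2 addr0 => /eqP.
rewrite addr_eq0 => /eqP; rewrite /c /x => ->.
by rewrite mulNr mulrN opprK mulrA.
Unshelve. all: by end_near. Qed.

Lemma frenet_kappa t i : I t -> (i < m)%N ->
  kappa i t = curv i (fun k => derive1n k.+1 s t).
Proof.
move=> It im.
have m0 : (0 < m)%N by lia.
(* Positivity stops at c_{m-1}, since kappa_{m-1} has no sign; c_m never occurs in a denominator. *)
have cpos k : (k < m.-1)%N -> 0 < c k.+1 t.
  elim: k => [|k IH] km; first by rewrite c1 // k_gt0.
  by rewrite cS; [|by []|lia]; rewrite !mulr_gt0 ?k_gt0 ?IH //; lia.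
have V n : (n <= m)%N -> vol n (fun k => derive1n k.+1 s t) = \prod_(i < n) c i.+1 t.
  apply: (@vol_prod _ _ _ _ (fun l => X l.+1 t)) => //.
  - by move=> a b am bm; rewrite one //; lia.
  - by case: fd => _ _ /(_ t It)[_ + _] _ _.
  - by move=> a l al lm; apply: (@trigX a.+1 _ l.+1 t) => //; lia.
case: i im => [|i] im; rewrite /curv /= !V; try lia.
  by rewrite big_ord1 c1.
rewrite big_ord1 c1 // [\prod_(_ < i.+2) _]big_ord_recr.
rewrite [\prod_(_ < i.+1) _]big_ord_recr /= (@cS i.+1 t) //.
set P := \prod_(_ < i) _.
have P0 : P != 0.
  by rewrite gt_eqF //; apply: prodr_gt0 => j _; apply: cpos; have := ltn_ord j; lia.
have C0 : c i.+1 t != 0 by rewrite gt_eqF // cpos //; lia.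
have K0 : kappa 0 t != 0 by rewrite gt_eqF // k_gt0 //; lia.
by field; rewrite P0 C0 K0.
Qed.

End frenet_unique.

(** * Existence of Frenet frames *)

(** The outcome of the Gram-Schmidt process. The positive diagonal makes the transition matrices
    have positive determinant, which is the equality of orientations in Frenet frames. *)
Definition gs_basis (R : realType) (m n : nat) (b e : nat -> 'rV[R]_m) : Prop :=
  [/\ forall i j, (i < n)%N -> (j < n)%N -> dot (e i) (e j) = (i == j)%:R,
      forall i, (i < n)%N -> b i = \sum_(l < n) dot (b i) (e l) *: e l,
      forall i l, (i < l)%N -> (l < n)%N -> dot (b i) (e l) = 0
    & forall i, (i < n)%N -> 0 < dot (b i) (e i)].

Section gs_basis.
Context {R : realType} {m n : nat} (b e : nat -> 'rV[R]_m).
Hypothesis gs : gs_basis n b e.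

Lemma gs_mul k : (k <= n)%N -> \matrix_(i < k) b i =
  (\matrix_(i < k, l < k) dot (b i) (e l)) *m \matrix_(l < k) e l.
Proof.
move=> kn; have [_ ex tr _] := gs; apply/row_matrixP => i; rewrite row_mul rowK.
have ik := ltn_ord i; rewrite {1}ex ?(leq_trans ik) // mulmx_sum_row.
rewrite (bigID (fun l : 'I_n => (l < k)%N)) /= [X in _ + X]big1 ?addr0.
  by rewrite (big_ord_narrow kn); apply: eq_bigr => l _; rewrite rowK !mxE.
by move=> l; rewrite -leqNgt => kl; rewrite tr ?scale0r // (leq_trans ik).
Qed.

Lemma gs_det k : (k <= n)%N -> 0 < \det (\matrix_(i < k, l < k) dot (b i) (e l)).
Proof.
move=> kn; have [_ _ tr pos] := gs; rewrite det_trig.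
  by apply: prodr_gt0 => i _; rewrite mxE pos // (leq_trans (ltn_ord i)).
by apply/is_trig_mxP => i l il; rewrite mxE tr // (leq_trans (ltn_ord l)).
Qed.

Lemma gs_sub k : (k <= n)%N -> (\matrix_(l < k) e l <= \matrix_(i < k) b i)%MS.
Proof.
move=> kn; rewrite gs_mul //; set L : 'M[R]_k := \matrix_(i, l) dot (b i) (e l).
have uL : L \in unitmx by rewrite unitmxE unitfE gt_eqF // gs_det.
by rewrite -{1}[\matrix_l e l](mulKmx uL) submxMl.
Qed.

Lemma gs_gram : 0 < \det ((\matrix_(i < n) b i) *m (\matrix_(i < n) b i)^T).
Proof.
have [one _ _ _] := gs.
rewrite gs_mul // trmx_mul mulmxA; set L : 'M[R]_n := \matrix_(i, l) dot (b i) (e l).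
rewrite -[L *m _ *m _]mulmxA.
have -> : (\matrix_(i < n) e i) *m (\matrix_(i < n) e i)^T = 1%:M.
  apply/matrixP => i j; rewrite !mxE -(inj_eq val_inj) /= -one //.
  by rewrite dotE; apply: eq_bigr => k _; rewrite !mxE.
by rewrite mulmx1 det_mulmx det_tr mulr_gt0 ?gs_det.
Qed.

End gs_basis.

Section smooth_gs.
Context {R : realType} {V : normedModType R} (U : set V) {m : nat}.

Definition smooth_vec (f : V -> 'rV[R]_m) := forall j, smooth_expr U (fun z => f z 0 j).

Lemma smooth_dot (f g : V -> 'rV[R]_m) : smooth_vec f -> smooth_vec g ->
  smooth_expr U (fun z => dot (f z) (g z)).
Proof.
move=> sf sg; rewrite (_ : (fun z => _) = fun z => \sum_i f z 0 i * g z 0 i).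
  by apply: smooth_expr_sum => i; apply: smooth_exprM.
by apply/funext => z; rewrite dotE.
Qed.

Lemma smooth_vec_scale (c : V -> R) (f : V -> 'rV[R]_m) :
  smooth_expr U c -> smooth_vec f -> smooth_vec (fun z => c z *: f z).
Proof.
move=> sc sf j; rewrite (_ : (fun z => _) = fun z => c z * f z 0 j).
  exact: smooth_exprM.
by apply/funext => z; rewrite mxE.
Qed.

Lemma row_free_rows_le k n (b : nat -> 'rV[R]_m) : (k <= n)%N ->
  row_free (\matrix_(i < n) b i) -> row_free (\matrix_(i < k) b i).
Proof.
move=> kn fr; have E := @rows_pid_mx R k n m b kn.
by rewrite E /row_free mxrankMfree // rank_pid_mx.
Qed.

(** Gram-Schmidt with parameters: each step uses only sums, products, the inverse and the root of a
    positive function, so smoothness in z persists. *)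
Lemma smooth_gs n (b : nat -> V -> 'rV[R]_m) :
  (forall i, smooth_vec (b i)) ->
  (forall z, U z -> row_free (\matrix_(i < n) b i z)) ->
  exists e : nat -> V -> 'rV[R]_m, (forall i, smooth_vec (e i)) /\
    forall z, U z -> gs_basis n (b ^~ z) (e ^~ z).
Proof.
move=> sb; elim: n => [|n IH] fr; first by exists b.
have [|e [se gse]] := IH.
  by move=> z Uz; exact: (@row_free_rows_le n n.+1 (b ^~ z) (leqnSn n) (fr z Uz)).
pose w z := b n z - \sum_(l < n) dot (b n z) (e l z) *: e l z.
have sw : smooth_vec w.
  move=> j; rewrite (_ : (fun z => _) = fun z =>
    b n z 0 j + -1 * \sum_(l < n) dot (b n z) (e l z) * e l z 0 j).
    apply: smooth_exprD; first exact: sb.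
    apply: smooth_exprM; first exact: smooth_expr_cst.
    apply: smooth_expr_sum => l; apply: smooth_exprM; last exact: se.
    exact: smooth_dot.
  apply/funext => z; rewrite !mxE mulN1r summxE; congr (_ - _).
  by apply: eq_bigr => l _; rewrite mxE.
have we z i : U z -> (i < n)%N -> dot (w z) (e i z) = 0.
  move=> Uz ni; have [one _ _ _] := gse z Uz.
  rewrite /w dotBl dot_suml (bigD1 (Ordinal ni)) //= big1 => [|l ln].
    by rewrite dotZl one // eqxx mulr1 addr0 subrr.
  rewrite dotZl one // (_ : l == i :> nat = false) ?mulr0 //.
  by apply: contraNF ln => /eqP li; apply/eqP/val_inj.
have w0 z : U z -> w z != 0.
  (* A vanishing remainder would put b_n in the span of the earlier rows and bound the rank of n+1
     independent rows by n. *)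
  move=> Uz; apply/eqP => /subr0_eq bn.
  have : (\rank (\matrix_(i < n.+1) b i z) <= n)%N.
    apply: leq_trans (rank_leq_row (\matrix_(i < n) b i z)).
    apply: mxrankS; apply/row_subP => i; rewrite rowK.
    have [iltn|] := ltnP i n.
      by rewrite -(rowK (fun i : 'I_n => b i z) (Ordinal iltn)) row_sub.
    move=> ni; have -> : i = n :> nat by apply/anti_leq; rewrite ni -ltnS ltn_ord.
    rewrite bn; apply: summx_sub => l _; apply: scalemx_sub.
    rewrite -(rowK (fun l : 'I_n => e l z) l).
    by apply: submx_trans (gs_sub (gse z Uz) (leqnn n)); apply: row_sub.
  by have /eqP -> := fr z Uz; rewrite ltnn.
have ww z : U z -> 0 < dot (w z) (w z) by move=> /w0; apply: dot_gt0.
have bw z i : U z -> (i < n)%N -> dot (b i z) (w z) = 0.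
  move=> Uz ni; have [_ ex _ _] := gse z Uz.
  rewrite ex // dot_suml big1 // => l _.
  by rewrite dotZl [dot (e l z) _]dotC we // mulr0.
have bnw z : U z -> dot (b n z) (w z) = dot (w z) (w z).
  move=> Uz; rewrite {2}/w dotBl dot_suml big1 ?subr0 // => l _.
  by rewrite dotZl [dot (e l z) _]dotC we // mulr0.
pose c z := (Num.sqrt (dot (w z) (w z)))^-1.
have c0 z : U z -> 0 < c z by move=> Uz; rewrite invr_gt0 sqrtr_gt0 ww.
have cww z : U z -> c z * c z * dot (w z) (w z) = 1.
  move=> Uz; rewrite -[X in _ * X]sqr_sqrtr ?(ltW (ww z Uz)) // /c.
  by rewrite -invfM -expr2 mulVf // gt_eqF // exprn_gt0 // sqrtr_gt0 ww.
exists (fun i z => if i == n then c z *: w z else e i z); split.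
  move=> i; case: (i == n) => //; apply: smooth_vec_scale => //.
  apply: smooth_exprV.
    by apply: smooth_expr_sqrt => //; apply: smooth_dot.
  by move=> z Uz; rewrite gt_eqF // sqrtr_gt0 ww.
move=> z Uz; have [one ex tr pos] := gse z Uz.
have En i : (i < n)%N -> (i == n) = false by move=> ni; rewrite ltn_eqF.
split.
- move=> i j; rewrite !ltnS => ni nj.
  have [ein|inn] := eqVneq i n; have [ejn|jnn] := eqVneq j n.
  + by rewrite dotZl dotZr mulrA cww // ein ejn eqxx.
  + by rewrite dotZl we ?mulr0 ?ein 1?eq_sym ?(negPf jnn) // ltn_neqAle jnn.
  + by rewrite dotC dotZl we ?mulr0 ?ejn ?(negPf inn) // ltn_neqAle inn.
  + by rewrite one // ltn_neqAle ?inn ?jnn.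
- move=> i; rewrite ltnS => ni; rewrite big_ord_recr /= eqxx.
  under eq_bigr do rewrite En //.
  rewrite dotZr !scalerA.
  have [->|inn] := eqVneq i n.
    by rewrite bnw // mulrAC cww // scale1r /w addrC subrK.
  have ni' : (i < n)%N by rewrite ltn_neqAle inn.
  by rewrite bw // mulr0 mul0r scale0r addr0 -ex.
- move=> i l il; rewrite ltnS => ln; have [ln'|lnn] := eqVneq l n.
    by rewrite dotZr bw ?mulr0 // -ln'.
  by rewrite tr // ltn_neqAle lnn.
- move=> i; rewrite ltnS => ni; have [->|inn] := eqVneq i n.
    by rewrite dotZr bnw // mulr_gt0 ?c0 ?ww.
  by rewrite pos // ltn_neqAle inn.
Qed.

End smooth_gs.

Lemma gram_gt0 (R : realType) (m n : nat) (b : nat -> 'rV[R]_m) :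
  row_free (\matrix_(i < n) b i) ->
  0 < \det ((\matrix_(i < n) b i) *m (\matrix_(i < n) b i)^T).
Proof.
(* A single system is treated as a constant family over the real line. *)
move=> fr; have [||e [_ gse]] := @smooth_gs R R^o setT m n (fun i _ => b i).
- by move=> i j; apply: smooth_expr_cst.
- by [].
- exact: (gs_gram (gse 0 I)).
Qed.

Lemma gram_row_free (R : realType) (m n : nat) (B : 'M[R]_(n, m)) :
  \det (B *m B^T) != 0 -> row_free B.
Proof.
rewrite -unitfE -unitmxE => /mxrank_unit h.
rewrite /row_free eqn_leq rank_leq_row /= -{1}h; exact: mxrankM_maxl.
Qed.

(** * The generalized cross product *)

Section cross_product.
Context {R : realType} {m : nat} (e : nat -> 'rV[R]_m.+1).
Hypothesis one : forall i j, (i < m)%N -> (j < m)%N -> dot (e i) (e j) = (i == j)%:R.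

Definition with_last (w : 'rV[R]_m.+1) (i : nat) := if (i < m)%N then e i else w.

(** The vector representing the functional w -> det(e_0, ..., e_{m-1}, w). Cofactors delete the last
    row, so the 0 placed there is a filler. *)
Definition cross : 'rV[R]_m.+1 :=
  \row_j cofactor (\matrix_(i < m.+1) with_last 0 i) ord_max j.

Lemma dot_cross w : dot w cross = \det (\matrix_(i < m.+1) with_last w i).
Proof.
rewrite dotE (expand_det_row _ ord_max); apply: eq_bigr => j _.
rewrite !mxE /with_last /= ltnn; congr (_ * _); rewrite /cofactor; congr (_ * \det _).
by apply/matrixP => a b; rewrite !mxE lift_max ltn_ord.
Qed.

Lemma dot_cross_e i : (i < m)%N -> dot (e i) cross = 0.
Proof.
move=> im; rewrite dot_cross; pose i' : 'I_m.+1 := widen_ord (leqnSn m) (Ordinal im).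
apply: (@determinant_alternate _ _ _ i' ord_max).
  by rewrite -(inj_eq val_inj) /= ltn_eqF.
by move=> j; rewrite !mxE /with_last /= im ltnn.
Qed.

(** The squared determinant is the Gram determinant of e_0, ..., e_{m-1}, w, and that Gram matrix is
    diagonal. *)
Lemma dot_cross_sqr w : (forall i, (i < m)%N -> dot (e i) w = 0) ->
  dot w cross ^+ 2 = dot w w.
Proof.
move=> we; rewrite dot_cross expr2 -{2}det_tr -det_mulmx.
have -> : (\matrix_(i < m.+1) with_last w i) *m (\matrix_(i < m.+1) with_last w i)^T =
    diag_mx (\row_i (if (i < m)%N then 1 else dot w w)).
  apply/matrixP => i j; rewrite !mxE.
  transitivity (dot (with_last w i) (with_last w j)).
    by rewrite dotE; apply: eq_bigr => k _; rewrite !mxE.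
  rewrite /with_last -(inj_eq val_inj) /=.
  have last_ (k : 'I_m.+1) : (k < m)%N = false -> k = m :> nat by have := ltn_ord k; lia.
  case im : (i < m)%N; case jm : (j < m)%N.
  - by rewrite one //; case: eqP.
  - by rewrite we // ltn_eqF // (last_ _ jm).
  - by rewrite dotC we // gtn_eqF // (last_ _ im).
  - by rewrite (last_ _ im) (last_ _ jm) eqxx.
rewrite det_diag big_ord_recr /= mxE /= ltnn big1 ?mul1r // => i _.
by rewrite mxE /= ltn_ord.
Qed.

(** The squared norm equals its own square, so it is 0 or 1; a nonzero vector orthogonal to all e_i
    rules out 0. *)
Lemma dot_cross_cross : dot cross cross = 1.
Proof.
have [w w0 we] : exists2 w : 'rV[R]_m.+1, w != 0 & forall i, (i < m)%N -> dot (e i) w = 0.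
  have : kermx (\matrix_(i < m) e i)^T != 0.
    by rewrite kermx_eq0 /row_free ltn_eqF // ltnS rank_leq_col.
  case/rowV0Pn => w wk w0; exists w => // i im.
  have /sub_kermxP/(congr1 (fun M : 'rV[R]_m => M 0 (Ordinal im))) := wk.
  rewrite !mxE => h; rewrite dotC dotE -[RHS]h.
  by apply: eq_bigr => j _; rewrite !mxE.
have h := dot_cross_sqr dot_cross_e.
have c0 : dot cross cross != 0.
  apply: contra_neq w0 => /dot_eq0 c0; apply: dot_eq0.
  by rewrite -dot_cross_sqr // c0 dot0r expr0n.
by apply: (mulfI c0); rewrite mulr1 -expr2.
Qed.

Lemma cross_onb i j : (i < m.+1)%N -> (j < m.+1)%N ->
  dot (with_last cross i) (with_last cross j) = (i == j)%:R.
Proof.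
rewrite !ltnS /with_last => im jm.
case: ltnP => im'; case: ltnP => jm'.
- exact: one.
- by rewrite dot_cross_e // ltn_eqF //; lia.
- by rewrite dotC dot_cross_e // gtn_eqF //; lia.
- by rewrite dot_cross_cross (_ : i == j) //; lia.
Qed.

Lemma cross_det : \det (\matrix_(i < m.+1) with_last cross i) = 1.
Proof. by rewrite -dot_cross dot_cross_cross. Qed.

End cross_product.

Section smooth_curves.
Context {R : realType} (I : set R).
Hypothesis opI : open I.

(** A class that contains, up to equality on the open set I, the derivative of each of its members
    consists of functions smooth on I. *)
Lemma derive1n_class (W : normedModType R) (P : (R -> W) -> Prop) :
  (forall f, P f -> exists2 g, P g & forall t : R, I t -> is_derive t 1 f (g t)) ->
  forall f, P f -> forall t, I t -> forall k, derivable (derive1n k f) t 1.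
Proof.
move=> PD f Pf t It k.
suff [g [Pg gE]] : exists g, P g /\ forall t, I t -> derive1n k f t = g t.
  have [g' _ dg] := PD g Pg.
  have [dg' _] := dg t It.
  apply: near_eq_derivable dg'.
  by near=> u; rewrite gE //; near: u; apply: open_nbhs_nbhs.
elim: k => [|k [g [Pg gE]]]; first by exists f.
have [g' Pg' dg] := PD g Pg; exists g'; split=> // u Iu.
rewrite derive1nS; have [_ <-] := dg u Iu; rewrite -derive1E.
apply: near_derive1.
by near=> v; apply: gE; near: v; apply: open_nbhs_nbhs.
Unshelve. all: by end_near. Qed.

Lemma smooth_expr_is_derive (f : R -> R) : smooth_expr (I : set R^o) f ->
  exists2 g, smooth_expr (I : set R^o) g & forall t : R, I t -> is_derive t 1 f (g t).
Proof.
move=> sf; have [df Df] := smooth_expr_derive sf.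
have [g sg Eg] := Df 1; exists g => // t It.
rewrite -Eg //; apply/derivableP/diff_derivable; exact: df.
Qed.

Lemma smooth_vec_is_derive m (f : R -> 'rV[R]_m) : smooth_vec (I : set R^o) f ->
  exists2 g, smooth_vec (I : set R^o) g & forall t : R, I t -> is_derive t 1 f (g t).
Proof.
move=> sf.
have /choice[g gP] j : exists g, smooth_expr (I : set R^o) g /\
    forall t : R, I t -> is_derive t 1 (fun x => f x 0 j) (g t).
  by have [g sg dg] := smooth_expr_is_derive (sf j); exists g.
exists (fun t => \row_j g j t).
  move=> j; rewrite (_ : (fun z => _) = g j); first by case: (gP j).
  by apply/funext => t; rewrite mxE.
move=> t It; apply/is_derive_mxP => i j; rewrite mxE ord1.
by case: (gP j) => _; apply.
Qed.

Lemma smooth_vec_curve m (f : R -> 'rV[R]_m) : smooth_vec (I : set R^o) f ->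
  smooth_curve I f.
Proof.
move=> sf; split=> //; apply: (derive1n_class (@smooth_vec_is_derive m)) => //.
Qed.

Lemma smooth_curve_vec m (s : R -> 'rV[R]_m) k : smooth_curve I s ->
  smooth_vec (I : set R^o) (derive1n k s).
Proof.
move=> sm j; apply: smooth_expr_atom => vs.
(* On the line, D_v is v times d/dt, so iterated directional derivatives are multiples of ordinary
   ones; c collects the product of the directions. *)
suff H (c : R) (g : R^o -> R^o) :
    (forall t, I t -> g t = c * derive1n k s t 0 j) ->
    forall t, I t -> differentiable (iter_derive g vs) t.
  by move=> t It; apply: (H 1) => // u _; rewrite mul1r.
elim: vs k c g => [|v vs IH] k c g gE t It /=.
  apply: (@near_eq_differentiable _ _ _ _ (fun t => c * derive1n k s t 0 j)).
    by near=> u; apply: gE; near: u; apply: open_nbhs_nbhs.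
  apply/derivable1_diffP.
  have /is_derive_mxP/(_ 0 j) h := smooth_curve_is_derive k sm It.
  by have [] := is_deriveZ c h.
apply: (IH k.+1 (c * v)) => // u Iu.
have /is_derive_mxP/(_ 0 j) h := smooth_curve_is_derive k sm Iu.
have hc : is_derive (u : R^o) 1 (fun t : R^o => c * derive1n k s t 0 j : R^o)
  (c * derive1n k.+1 s u 0 j) by exact: is_deriveZ.
have hg : is_derive (u : R^o) 1 g (c * derive1n k.+1 s u 0 j).
  apply: near_eq_is_derive hc.
  by near=> w; rewrite gE //; near: w; apply: open_nbhs_nbhs.
have [dg Dg] := hg; have dg' : differentiable g u by apply/derivable1_diffP.
rewrite deriveE // diff1E // derive1E Dg.
by rewrite -[LHS]/(v * _) mulrCA mulrA.
Unshelve. all: by end_near. Qed.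

End smooth_curves.

Lemma onb_eq (R : realType) (m : nat) (e : nat -> 'rV[R]_m) (u v : 'rV[R]_m) :
  (forall i j, (i < m)%N -> (j < m)%N -> dot (e i) (e j) = (i == j)%:R) ->
  (forall l, (l < m)%N -> dot u (e l) = dot v (e l)) -> u = v.
Proof.
move=> one uv; rewrite (onb_expand one u) (onb_expand one v).
by apply: eq_bigr => l _; rewrite uv.
Qed.

Section frenet_exists.
Context {R : realType} {n : nat} (I : set R) (s : R -> 'rV[R]_n.+1).
Hypotheses (sm : smooth_curve I s) (fr : forall t, I t -> frenet_at s t).

Let opI : open I. Proof. by case: sm. Qed.

Let b i t := derive1n i.+1 s t.

Variable e : nat -> R -> 'rV[R]_n.+1.
Hypothesis se : forall i, smooth_vec (I : set R^o) (e i).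
Hypothesis gse : forall t, I t -> gs_basis n (b ^~ t) (e ^~ t).

Let E i t := with_last (e ^~ t) (cross (e ^~ t)) i.

Let one t : I t -> forall i j, (i < n.+1)%N -> (j < n.+1)%N ->
  dot (E i t) (E j t) = (i == j)%:R.
Proof. by move=> It i j; apply: cross_onb; case: (gse It). Qed.

Lemma smooth_frame i :
  smooth_vec (I : set R^o) (fun t => with_last (e ^~ t) (cross (e ^~ t)) i).
Proof.
rewrite /with_last; case: ltnP => // _ j.
rewrite (_ : (fun z => _) = fun z =>
    (-1) ^+ (n + j) *
    \det (row' ord_max (col' j (\matrix_(a < n.+1) with_last (e ^~ z) 0 a)))).
  apply: smooth_exprM; first exact: smooth_expr_cst.
  apply: smooth_expr_det => k l.
  rewrite (_ : (fun z => _) = fun z => e k z 0 (lift j l)); first exact: se.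
  by apply/funext => z; rewrite !mxE /with_last lift_max ltn_ord.
by apply/funext => z; rewrite mxE.
Qed.

Let trigE t i l : I t -> (i < l <= n)%N -> dot (b i t) (E l t) = 0.
Proof.
move=> It /andP[il ln]; have [on1 ex tr _] := gse It.
rewrite /E /with_last; case: ltnP => ln'; first exact: tr.
rewrite ex ?(leq_trans il) // dot_suml big1 // => a _.
by rewrite dotZl (dot_cross_e (e ^~ t)) // mulr0.
Qed.

Let posE t i : I t -> (i < n)%N -> 0 < dot (b i t) (E i t).
Proof.
move=> It lt_in; case: (gse It) => _ _ _ /(_ i lt_in).
by rewrite /E /with_last lt_in.
Qed.

Let sE i : smooth_vec (I : set R^o) (E i) := smooth_frame i.

Variable dE : nat -> R -> 'rV[R]_n.+1.
Hypothesis dEP : forall i (t : R), I t -> is_derive t 1 (E i) (dE i t).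

Let dE_anti t i j : I t -> (i <= n)%N -> (j <= n)%N ->
  dot (dE i t) (E j t) = - dot (E i t) (dE j t).
Proof.
move=> It lin ljn; apply/eqP; rewrite -addr_eq0; apply/eqP.
have [_ <-] := is_derive_dot (dEP i It) (dEP j It).
rewrite (near_eq_derive (g := fun=> (i == j)%:R : R)) ?derive_cst //.
by near=> u; rewrite one //; near: u; apply: open_nbhs_nbhs.
Unshelve. all: by end_near. Qed.

Let b_dE t i l : I t -> (i < l <= n)%N -> dot (b i t) (dE l t) = - dot (b i.+1 t) (E l t).
Proof.
move=> It il; apply/eqP; rewrite -addr_eq0 addrC; apply/eqP.
have [_ <-] := is_derive_dot (smooth_curve_is_derive i.+1 sm It) (dEP l It).
rewrite (near_eq_derive (g := fun=> 0 : R)) ?derive_cst //.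
by near=> u; rewrite -/(b i u) trigE //; near: u; apply: open_nbhs_nbhs.
Unshelve. all: by end_near. Qed.

(** Expand b_i in E_0, ..., E_i and pair with E_j'. By induction the terms l < i carry the factor
    <b_{l+1}, E_j>, which vanishes as l+1 <= i < j, so only E_i remains. *)
Let E_dE t i j : I t -> (i < j <= n)%N ->
  dot (E i t) (dE j t) = - dot (b i.+1 t) (E j t) / dot (b i t) (E i t).
Proof.
move=> It; elim/ltn_ind: i => i IH ij.
have p0 : dot (b i t) (E i t) != 0 by rewrite gt_eqF // posE //; lia.
apply: (mulIf p0); rewrite divfK // -b_dE //.
have i_lt : (i < n.+1)%N by lia.
rewrite {2}(@onb_expand _ _ (E ^~ t) (one It) (b i t)) dot_suml.
rewrite (bigD1 (Ordinal i_lt)) //= big1.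
  by rewrite addr0 dotZl mulrC.
move=> l li; rewrite dotZl.
have : (l < i)%N || (i < l)%N.
  by rewrite -neq_ltn; apply: contra li => /eqP h; apply/eqP/val_inj.
case/orP => li'; last by rewrite trigE ?mul0r // li' -ltnS ltn_ord.
rewrite IH //; last by lia.
by rewrite (@trigE t l.+1 j) ?oppr0 ?mul0r ?mulr0 //; lia.
Qed.

(** The ratio c_{j+1} / c_j, hence the future kappa_0 kappa_j: the curvature measured per unit of
    t. *)
Let p j t := dot (b j t) (E j t) / dot (b j.-1 t) (E j.-1 t).

(** <E_l, E_j'> with l < j is a multiple of <b_{l+1}, E_j>, zero unless l+1 = j. Antisymmetry
    handles l > j, so E_j' has components only along the two neighbours. *)
Let dE_eq t j : I t -> (j <= n)%N ->
  dE j t = (if (0 < j)%N then - p j t *: E j.-1 t else 0) +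
           (if (j < n)%N then p j.+1 t *: E j.+1 t else 0).
Proof.
move=> It jn; apply: (@onb_eq _ _ (E ^~ t) _ _ (one It)) => l; rewrite ltnS => ln.
have R1 : dot (if (0 < j)%N then - p j t *: E j.-1 t else 0) (E l t) =
    if (l.+1 == j)%N then - p j t else 0.
  case: j jn => [|j] jn /=; first by rewrite dot0l.
  rewrite dotZl one //; last exact: ltnW.
  by rewrite eqSS eq_sym; case: eqP; rewrite ?mulr1 ?mulr0.
have R2 : dot (if (j < n)%N then p j.+1 t *: E j.+1 t else 0) (E l t) =
    if (l == j.+1)%N then p j.+1 t else 0.
  case: ltnP => jn'; last by rewrite dot0l; case: eqP => // h; lia.
  by rewrite dotZl one // eq_sym; case: eqP; rewrite ?mulr1 ?mulr0.
rewrite dotDl R1 R2.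
have [lj|jl|->] := ltngtP l j.
- rewrite (_ : l == j.+1 = false) ?addr0; last by lia.
  rewrite dotC E_dE ?lj //; case: eqP => [<-|lj']; first by rewrite /p mulNr.
  by rewrite trigE ?oppr0 ?mul0r //; lia.
- rewrite (_ : l.+1 == j = false) ?add0r; last by lia.
  rewrite dE_anti // E_dE ?jl // mulNr opprK.
  case: eqP => [->|lj']; first by [].
  by rewrite trigE ?mul0r //; lia.
- rewrite gtn_eqF // ltn_eqF // addr0.
  by have := dE_anti It jn jn; rewrite [dot (E j t) _]dotC; lra.
Qed.

Let X i := E i.-1.
Let kappa i t := if i is 0 then dot (b 0 t) (E 0 t) else p i t / dot (b 0 t) (E 0 t).

Let smooth_p i : (0 < i <= n)%N -> smooth_expr (I : set R^o) (p i).
Proof.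
move=> i1; apply: smooth_exprM; first by apply: smooth_dot => //; apply: smooth_curve_vec.
apply: smooth_exprV; first by apply: smooth_dot => //; apply: smooth_curve_vec.
by move=> t It; rewrite gt_eqF // posE //; lia.
Qed.

Lemma frenet_data_of_gs : frenet_data I s X kappa.
Proof.
have k00 t : I t -> (0 < n)%N -> dot (b 0 t) (E 0 t) != 0.
  by move=> It n0; rewrite gt_eqF // posE.
split.
- by [].
- split=> [i _|i lt_in t It k].
    by apply: (smooth_vec_curve opI); exact: sE.
  apply: (derive1n_class opI (@smooth_expr_is_derive _ _)) => //.
  have s0 : smooth_expr (I : set R^o) (fun t => dot (b 0 t) (E 0 t)).
    by apply: smooth_dot => //; apply: smooth_curve_vec.
  case: i lt_in => [|i] lt_in; first exact: s0.
  apply: smooth_exprM; first by apply: smooth_p; lia.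
  by apply: smooth_exprV => // u Iu; apply: k00 => //; lia.
- move=> t It; split.
  + move=> i j i1 j1; rewrite euclideanE /X one //; try lia.
    by congr (_%:R); lia.
  + have := cross_det (e := e ^~ t); rewrite /X /E /= => -> //.
    by case: (gse It).
  + move=> i i1.
    exists (\matrix_(a < i, l < i) dot (b a t) (e l t)); split.
      by apply: (gs_det (gse It)); move: i1; rewrite /=; lia.
    have i_n : (i <= n)%N by lia.
    rewrite -[LHS]/(\matrix_(k < i) (b^~ t) k) (gs_mul (gse It) i_n).
    congr (_ *m _); apply/row_matrixP => l; rewrite !rowK /X /E /with_last /=.
    by rewrite (leq_trans (ltn_ord l) i_n).
- move=> t It [|j] /= jn; first exact: posE.
  rewrite !divr_gt0 ?posE //; lia.
- have DX i t : I t -> derive1 (X i) t = dE i.-1 t.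
    by move=> It; apply: is_derive_derive1; exact: dEP.
  move=> t It; split.
  + rewrite -derive1n1 -/(b 0 t) {1}(@onb_expand _ _ (E ^~ t) (one It) (b 0 t)).
    rewrite big_ord_recl /= big1 ?addr0 // => l _; rewrite trigE ?scale0r //.
    by rewrite /bump /= ltn_ord.
  + move=> n1; rewrite /= DX // dE_eq //= add0r.
    have n0 : (0 < n)%N by lia.
    by rewrite n0 scalerA mulrC.
  + move=> [|[|i]] //= i1; rewrite DX // dE_eq //=; last lia.
    rewrite (_ : (i.+1 < n)%N) ?scalerDr ?scalerA; last lia.
    by congr (_ *: _ + _ *: _); rewrite ?mulrN mulrC.
  + move=> n1; have n0 : (0 < n)%N by lia.
    have kE i : (0 < i)%N -> kappa i t = p i t / dot (b 0 t) (E 0 t) by case: i.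
    rewrite DX // dE_eq // n0 ltnn addr0 scalerA (kE n.+1.-1) // mulrN mulrC.
    by [].

Qed.

End frenet_exists.

Lemma frenet_exists (R : realType) (n : nat) (I : set R) (s : R -> 'rV[R]_n.+1) :
  smooth_curve I s -> (forall t, I t -> frenet_at s t) ->
  exists X kappa, frenet_data I s X kappa.
Proof.
move=> sm fr; have opI : open I by case: sm.
have [||e [se gse]] := @smooth_gs R R^o I n.+1 n (fun i => derive1n i.+1 s).
- by move=> i; apply: smooth_curve_vec.
- by move=> t It; apply: fr.
have /choice[dE dEP] i : exists g, forall t : R, I t ->
    is_derive t 1 (fun t => with_last (e ^~ t) (cross (e ^~ t)) i) (g t).
  by have [g _ dg] := smooth_vec_is_derive (smooth_frame se i); exists g.
do 2!eexists; exact: (frenet_data_of_gs sm fr se gse dEP).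
Qed.

(** * Curvatures on jets *)

Lemma vol_rot (R : realType) (m n : nat) (b b' : nat -> 'rV[R]_m) (Q : 'M[R]_m) :
  Q *m Q^T = 1%:M -> \det Q = 1 -> (n <= m)%N ->
  (forall k, (k < n)%N -> b' k = b k *m Q) -> vol n b' = vol n b.
Proof.
move=> QQ dQ nm bb; rewrite /vol.
have E k : (k <= n)%N -> \matrix_(i < k) b' i = (\matrix_(i < k) b i) *m Q.
  move=> kn; apply/row_matrixP => i; rewrite row_mul !rowK bb //.
  exact: leq_trans (ltn_ord i) kn.
case: ltnP => nm'; last by rewrite E // det_mulmx dQ mulr1.
by rewrite E // trmx_mul mulmxA -[_ *m Q *m _]mulmxA QQ mulmx1.
Qed.

Lemma curv_rot (R : realType) (m i : nat) (b b' : nat -> 'rV[R]_m) (Q : 'M[R]_m) :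
  Q *m Q^T = 1%:M -> \det Q = 1 -> (i < m)%N ->
  (forall k, (k <= i)%N -> b' k = b k *m Q) -> curv i b' = curv i b.
Proof.
move=> QQ dQ im bb.
have E n : (n <= i.+1)%N -> vol n b' = vol n b.
  move=> ni; apply: (vol_rot QQ dQ); first exact: leq_trans ni im.
  by move=> k kn; apply: bb; rewrite -ltnS (leq_trans kn).
by case: i im bb E => [|i] im bb E; rewrite /curv !E //; lia.
Qed.

Lemma vol_ext (R : realType) (m n : nat) (b b' : nat -> 'rV[R]_m) : (n <= m)%N ->
  (forall k, (k < n)%N -> b' k = b k) -> vol n b' = vol n b.
Proof.
move=> nm bb; apply: (@vol_rot _ _ _ _ _ 1%:M) => // [||k kn].
- by rewrite trmx1 mulmx1.
- by rewrite det1.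
- by rewrite mulmx1 bb.
Qed.

Lemma curv_ext (R : realType) (m i : nat) (b b' : nat -> 'rV[R]_m) : (i < m)%N ->
  (forall k, (k <= i)%N -> b' k = b k) -> curv i b' = curv i b.
Proof.
move=> im bb; apply: (@curv_rot _ _ _ _ _ 1%:M) => // [||k ki].
- by rewrite trmx1 mulmx1.
- by rewrite det1.
- by rewrite mulmx1 bb.
Qed.

Lemma vol_gt0 (R : realType) (m n : nat) (b : nat -> 'rV[R]_m) : (n < m)%N ->
  row_free (\matrix_(i < m.-1) b i) -> 0 < vol n b.
Proof.
move=> nm fr; rewrite /vol nm sqrtr_gt0 gram_gt0 //.
by apply: row_free_rows_le fr; lia.
Qed.

Definition jrow (R : realType) (m r : nat) (z : jets R m r) (k : nat) : 'rV[R]_m :=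
  row (inord k) z.2.

(* The derivatives x_1, x_2, ... of the jet, numbered from 0. *)
Definition jder (R : realType) (m r : nat) (z : jets R m r) (k : nat) : 'rV[R]_m :=
  jrow z k.+1.

Lemma jder_affine (R : realType) (m r : nat) (z v : jets R m r) (a : R) k :
  jder (a *: v + z) k = a *: jder v k + jder z k.
Proof. by rewrite /jder /jrow /= linearD linearZ. Qed.

Lemma jrow_jet (R : realType) (m r : nat) (s : R -> 'rV[R]_m) t k : (k <= r)%N ->
  jrow (jet r s t) k = derive1n k s t.
Proof. by move=> kr; rewrite /jrow rowK inordK. Qed.

Lemma frenet_domP (R : realType) (m : nat) (z : jets R m m) :
  frenet_dom R m z <-> row_free (\matrix_(k < m.-1) jder z k).
Proof.
have [s [sm jz]] := jet_surj z.
have E : jet_proj m.-1 z = jet m.-1 s z.1.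
  rewrite -{1}jz; apply: (f_equal2 pair) => //=.
  apply/row_matrixP => k; rewrite !rowK inordK //.
  by rewrite (leq_trans (ltn_ord k)) //; lia.
rewrite /frenet_dom /preimage /= E (frenet_jetsP sm) // /frenet_at.
suff -> : \matrix_(k < m.-1) jder z k = \matrix_(k < m.-1) derive1n k.+1 s z.1 by [].
apply/row_matrixP => k; rewrite !rowK -{1}jz /jder jrow_jet //.
by have := ltn_ord k; lia.
Qed.

Definition jcurv (R : realType) (m i : nat) (z : jets R m m) : R := curv i (jder z).

(** Every candidate value equals [jcurv i z] by uniqueness. The default value of [xget] is avoided
    by exhibiting a Frenet curve through the jet. *)
Lemma varkappaE (R : realType) (m i : nat) (z : jets R m m) : (i < m)%N ->
  frenet_dom R m z -> varkappa i z = jcurv i z.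
Proof.
case: m z => // n z im /frenet_domP fr.
have [s [sm jz]] := jet_surj z.
rewrite /varkappa; set S := [set y | _].
have SE y : S y -> y = jcurv i z.
  move=> [I [s' [X [kappa [fd It jz' ->]]]]].
  rewrite (frenet_kappa fd It im); apply: curv_ext => // k ki.
  by rewrite -jz' /jder jrow_jet //; lia.
apply: SE; apply: xgetPex.
pose g (t : R) := \det ((\matrix_(k < n) derive1n k.+1 s t) *m
                        (\matrix_(k < n) derive1n k.+1 s t)^T).
have sv k := smooth_curve_vec (openT : open (setT : set R)) k sm.
have cg : continuous (g : R^o -> R^o).
  apply: smooth_expr_continuous; apply: smooth_expr_det => a b.
  rewrite (_ : (fun t => _) = fun t => dot (derive1n a.+1 s t) (derive1n b.+1 s t)).
    exact: smooth_dot.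
  by apply/funext => t; rewrite mxE dotE; apply: eq_bigr => c _; rewrite !mxE.
(* The Taylor curve is Frenet at one parameter only by assumption; nonvanishing of its Gram
   determinant extends this to an open set. *)
pose I : set R := [set t | g t != 0].
have opI : open I.
  rewrite openE => t It; rewrite /interior /=.
  exact: cvgr_neq0 (cg t) It.
have frI t : I t -> frenet_at s t by exact: gram_row_free.
have smI : smooth_curve I s.
  by split=> // t _ k; case: sm => _; apply.
have [X [kappa fd]] := frenet_exists smI frI.
exists (kappa i z.1), I, s, X, kappa; split=> //.
rewrite /I /= gt_eqF // /g.
have -> : \matrix_(k < n) derive1n k.+1 s z.1 = \matrix_(k < n) jder z k.
  apply/row_matrixP => k; rewrite !rowK -{2}jz /jder jrow_jet //.
  by have := ltn_ord k; lia.
exact: gram_gt0.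
Qed.

Lemma open_frenet_dom (R : realType) (m : nat) : open (frenet_dom R m).
Proof.
rewrite openE => z /frenet_domP fr; rewrite /interior /=.
pose g (w : jets R m m) := \det ((\matrix_(k < m.-1) jder w k) *m
                                 (\matrix_(k < m.-1) jder w k)^T).
have cg : continuous (g : _ -> R^o).
  apply: smooth_expr_continuous; apply: smooth_expr_det => a b.
  rewrite (_ : (fun t => _) = fun w => dot (jder w a) (jder w b)).
    apply: smooth_dot => j.
      rewrite (_ : (fun z => _) = fun w : jets R m m => w.2 (inord a.+1) j).
        exact: smooth_jet_coord.
      by apply/funext => w; rewrite mxE.
    rewrite (_ : (fun z => _) = fun w : jets R m m => w.2 (inord b.+1) j).
      exact: smooth_jet_coord.
    by apply/funext => w; rewrite mxE.
  by apply/funext => t; rewrite mxE dotE; apply: eq_bigr => c _; rewrite !mxE.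
have gz : g z != 0 by rewrite gt_eqF // gram_gt0.
have : \forall w \near z, g w != 0 by exact: cvgr_neq0 (cg z) gz.
apply: filterS => w gw; apply/frenet_domP; exact: gram_row_free.
Qed.

(** The difference quotients coincide, so nothing is assumed about differentiability, and the two
    functions may live on different spaces. *)
Lemma derive_ext (R : realType) (V V' W : normedModType R) (f : V -> W)
    (g : V' -> W) z v z' v' :
  (forall a : R, f (a *: v + z) = g (a *: v' + z')) -> 'D_v f z = 'D_v' g z'.
Proof.
move=> fg; rewrite /derive; set F := fun h => h^-1 *: _; set G := fun h => h^-1 *: _.
suff -> : F = G by [].
apply/funext => a; rewrite /F /G /= fg.
by have := fg 0; rewrite !scale0r !add0r => ->.
Qed.

Lemma derive_affine (R : realType) (V : normedModType R) (f : V -> R) z v (c d : R) :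
  (\forall a \near (0 : R), f (a *: v + z) = c + a * d) ->
  'D_v (f : V -> R^o) z = d.
Proof.
move=> fE; pose g (a : R^o) : R^o := f (a *: v + z).
rewrite (@derive_ext _ _ R^o _ _ g z v 0 1); last first.
  by move=> a; rewrite /g addr0 [a *: 1]mulr1.
rewrite (@near_eq_derive _ _ _ _ (cst c + (fun a : R^o => d *: (a : R^o)))).
  have h : is_derive (0 : R^o) 1 (cst c + (fun a : R^o => d *: (a : R^o))) (0 + d *: 1).
    exact: is_deriveD.
  by rewrite (@derive_val _ _ _ _ _ _ _ h) add0r [d *: 1]mulr1.
near=> a; rewrite -[RHS]/(c + d * a) mulrC.
by near: a.
Unshelve. all: by end_near. Qed.

Lemma deriveZ_dir (R : realType) (V W : normedModType R) (f : V -> W) z v (a : R) :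
  differentiable f z -> 'D_(a *: v) f z = a *: 'D_v f z.
Proof. by move=> df; rewrite !deriveE // linearZ. Qed.

Lemma deriveD_dir (R : realType) (V W : normedModType R) (f : V -> W) z u v :
  differentiable f z -> 'D_(u + v) f z = 'D_u f z + 'D_v f z.
Proof. by move=> df; rewrite !deriveE // linearD. Qed.

Lemma derive_jetE (R : realType) (m r : nat) (f : jets R m r -> R) z v :
  differentiable (f : _ -> R^o) z ->
  'D_v (f : _ -> R^o) z = v.1 * 'D_((1, 0) : jets R m r) (f : _ -> R^o) z +
    \sum_k \sum_i v.2 k i * 'D_((0, delta_mx k i) : jets R m r) (f : _ -> R^o) z.
Proof.
move=> df; rewrite deriveE //; set L := 'd _ z.
have {1}-> : v = v.1 *: ((1, 0) : jets R m r) +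
    \sum_k \sum_i v.2 k i *: ((0, delta_mx k i) : jets R m r).
  case: v => t M; apply: (f_equal2 pair) => /=.
    rewrite (big_morph (fst : jets R m r -> R^o) (id1 := 0) (op1 := +%R)) //.
    rewrite big1 ?addr0 => [|k _]; first by rewrite [_ *: 1]mulr1.
    rewrite (big_morph (fst : jets R m r -> R^o) (id1 := 0) (op1 := +%R)) //.
    by rewrite big1 // => i _; rewrite /= scaler0.
  rewrite (big_morph (snd : jets R m r -> _) (id1 := 0) (op1 := +%R)) //.
  rewrite scaler0 add0r {1}[M]matrix_sum_delta; apply: eq_bigr => k _.
  by rewrite (big_morph (snd : jets R m r -> _) (id1 := 0) (op1 := +%R)).
rewrite linearD linearZ /= linear_sum deriveE //; congr (_ + _).
apply: eq_bigr => k _; rewrite linear_sum; apply: eq_bigr => i _.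
by rewrite linearZ deriveE.
Qed.

Section prolonged_derivative.
Context {R : realType} {m : nat}.
Implicit Types z v : jets R m m.

(* The total derivative, as a vector field on J^m with x_{m+1} replaced by 0. *)
Definition shift_jet z : jets R m m :=
  (1, \matrix_(k < m.+1) (if (k < m)%N then jrow z k.+1 else 0)).

(** It can be iterated without change of type. A function of x_1, ..., x_{m-1} alone never meets the
    missing x_{m+1}, and the result then depends on x_1, ..., x_m. *)
Definition trunc_total (f : jets R m m -> R) z : R :=
  'D_(shift_jet z) (f : _ -> R^o) z.

Definition jcurv_iter h i : jets R m m -> R := iter h trunc_total (jcurv i).

Lemma jder_shift z k : (k < m)%N ->
  jder (shift_jet z) k = if (k.+1 < m)%N then jder z k.+1 else 0.
Proof. by move=> km; rewrite /jder /jrow rowK inordK. Qed.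

(** Shifting a jet commutes with the rotation, so the whole line of z' is the rotated line of z.
    Comparing only the rows up to h+i yields invariance and, for Q = 1, dependence on the
    (h+i+1)-jet alone. *)
Lemma jcurv_iter_rot h i z z' (Q : 'M[R]_m) :
  Q *m Q^T = 1%:M -> \det Q = 1 -> (h + i < m)%N ->
  (forall k, (k <= h + i)%N -> jder z' k = jder z k *m Q) ->
  jcurv_iter h i z' = jcurv_iter h i z.
Proof.
move=> QQ dQ; elim: h z z' => [|h IH] z z' him zz'; first exact: curv_rot QQ dQ _ _.
apply: derive_ext => a; apply: IH => [|k ki]; first exact: ltnW.
rewrite !jder_affine mulmxDl -scalemxAl zz' ?(leq_trans ki) ?leq_add2r //.
rewrite !jder_shift; try lia.
by rewrite (_ : (k.+1 < m)%N) ?zz' //; lia.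
Qed.

Lemma jcurv_iter_ext h i z z' : (h + i < m)%N ->
  (forall k, (k <= h + i)%N -> jder z' k = jder z k) ->
  jcurv_iter h i z' = jcurv_iter h i z.
Proof.
move=> him zz'; apply: (@jcurv_iter_rot _ _ _ _ 1%:M) => // [||k ki].
- by rewrite trmx1 mulmx1.
- by rewrite det1.
- by rewrite mulmx1 zz'.
Qed.

Lemma smooth_jder (U : set (jets R m m)) k : smooth_vec U (fun z => jder z k).
Proof.
move=> j; rewrite (_ : (fun z => _) = fun w : jets R m m => w.2 (inord k.+1) j).
  exact: smooth_jet_coord.
by apply/funext => w; rewrite mxE.
Qed.

Lemma smooth_vol n : (n <= m)%N -> smooth_expr (frenet_dom R m) (fun z => vol n (jder z)).
Proof.
move=> nm; rewrite /vol; case: ltnP => nm'.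
  apply: smooth_expr_sqrt.
    apply: smooth_expr_det => a b.
    rewrite (_ : (fun t => _) = fun w => dot (jder w a) (jder w b)).
      by apply: smooth_dot; apply: smooth_jder.
    by apply/funext => t; rewrite mxE dotE; apply: eq_bigr => c _; rewrite !mxE.
  move=> z /frenet_domP fr; apply: gram_gt0; apply: row_free_rows_le fr; lia.
apply: smooth_expr_det => a b.
rewrite (_ : (fun t => _) = fun w => jder w a 0 b); first exact: smooth_jder.
by apply/funext => t; rewrite mxE.
Qed.

Lemma smooth_jcurv i : (i < m)%N -> smooth_expr (frenet_dom R m) (jcurv i).
Proof.
move=> im; rewrite /jcurv /curv; case: i im => [|i] im; first exact: smooth_vol.
apply: smooth_exprM; first by apply: smooth_exprM; apply: smooth_vol; lia.
apply: smooth_exprV.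
  by apply: smooth_exprM; [|apply: smooth_exprM]; apply: smooth_vol; lia.
by move=> z /frenet_domP fr; rewrite gt_eqF // !mulr_gt0 // vol_gt0 //; lia.
Qed.

(** A truncated derivative is a sum of partial derivatives times coordinates of the jet, which keeps
    it in the smooth class. Agreement on the open Frenet domain suffices for differentiating
    again. *)
Lemma smooth_jcurv_iter h i : (i < m)%N ->
  exists2 g, smooth_expr (frenet_dom R m) g &
    forall z, frenet_dom R m z -> jcurv_iter h i z = g z.
Proof.
have opU := @open_frenet_dom R m.
move=> im; elim: h => [|h [g sg gE]].
  by exists (jcurv i) => //; exact: smooth_jcurv.
have [dg Dg] := smooth_expr_derive sg.
have [g0 sg0 g0E] := Dg ((1, 0) : jets R m m).
have /choice[g1 g1P] ki : exists g', smooth_expr (frenet_dom R m) g' /\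
    forall z, frenet_dom R m z ->
      'D_((0, delta_mx ki.1 ki.2) : jets R m m) (g : _ -> R^o) z = g' z.
  by have [g' sg' g'E] := Dg ((0, delta_mx ki.1 ki.2) : jets R m m); exists g'.
exists (fun z => g0 z + \sum_k \sum_i (shift_jet z).2 k i * g1 (k, i) z).
  apply: smooth_exprD => //; apply: smooth_expr_sum => k; apply: smooth_expr_sum => j.
  apply: smooth_exprM; last by case: (g1P (k, j)).
  have [km|km] := ltnP k m.
    rewrite (_ : (fun z => _) = fun z => jder z k 0 j); first exact: smooth_jder.
    by apply/funext => z; rewrite !mxE km /jder /jrow mxE.
  rewrite (_ : (fun z => _) = fun=> 0); first exact: smooth_expr_cst.
  by apply/funext => z; rewrite !mxE ltnNge km /= mxE.
move=> z Uz; rewrite /jcurv_iter iterS -/(jcurv_iter h i) /trunc_total.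
rewrite (near_eq_derive (g := (g : _ -> R^o))); last first.
  by near=> w; apply: gE; near: w; apply: open_nbhs_nbhs.
rewrite derive_jetE; last exact: dg.
rewrite mul1r g0E //; congr (_ + _); apply: eq_bigr => k _; apply: eq_bigr => j _.
by congr (_ * _); case: (g1P (k, j)) => _; apply.
Unshelve. all: by end_near. Qed.

Lemma smooth_on_jcurv_iter h i : (i < m)%N ->
  smooth_on (frenet_dom R m) (jcurv_iter h i : _ -> R^o).
Proof.
move=> im; have [g sg gE] := smooth_jcurv_iter h im.
exact: smooth_expr_smooth (@open_frenet_dom R m) _ _ sg gE.
Qed.

Lemma differentiable_jcurv_iter h i z : (i < m)%N -> frenet_dom R m z ->
  differentiable (jcurv_iter h i : _ -> R^o) z.
Proof.
by move=> im Uz; apply: smooth_on_differentiable (smooth_on_jcurv_iter h im) Uz.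
Qed.

(* Cayley transform: 1 + a A = (1 - a A) Q with Q a rotation, so that an
   invariant function is even along the prolonged field A. *)
Lemma antisym_cayley (A : 'M[R]_m) (a : R) : A^T = - A ->
  exists Q, [/\ Q *m Q^T = 1%:M, \det Q = 1 & 1%:M + a *: A = (1%:M - a *: A) *m Q].
Proof.
move=> AT; set N := 1%:M + a *: A; set M := 1%:M - a *: A.
have MT : M^T = N.
  by rewrite /M /N linearB /= trmx1 linearZ /= AT scalerN opprK.
have uM : M \in unitmx.
  rewrite -row_free_unit -kermx_eq0; apply/rowV0P => u /sub_kermxP.
  rewrite mulmxBr mulmx1 -scalemxAr => /subr0_eq uE.
  by apply: dot_eq0; rewrite {1}uE dotZl dot_antisym0 // mulr0.
have uN : N \in unitmx by rewrite -MT unitmx_tr.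
have NM : N *m M = M *m N.
  rewrite /M [LHS]mulmxBr [RHS]mulmxBl mulmx1 mul1mx /N.
  by rewrite [X in _ - X = _]mulmxDl [X in _ = _ - X]mulmxDr mulmx1 mul1mx.
exists (invmx M *m N); split.
- have NT : N^T = M by rewrite -MT trmxK.
  rewrite trmx_mul NT trmx_inv MT mulmxA -[invmx M *m N *m M]mulmxA NM mulKmx //.
  by rewrite mulmxV.
- rewrite det_mulmx det_inv -[\det N]det_tr -MT trmxK mulVf //.
  by move: uM; rewrite unitmxE unitfE.
- by rewrite mulKVmx.
Qed.

Lemma jder_prolonged (A : 'M[R]_m) b z k : (k < m)%N ->
  jder (prolonged_field A b z) k = jder z k *m A.
Proof.
move=> km; rewrite /jder /jrow /= linearD /= row_mul row_in_row0 inordK //.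
by rewrite scale0r addr0.
Qed.

Lemma jcurv_iter_invariant h i (A : 'M[R]_m) b z : A^T = - A -> (h + i < m)%N ->
  frenet_dom R m z -> 'D_(prolonged_field A b z) (jcurv_iter h i : _ -> R^o) z = 0.
Proof.
move=> AT him Uz; set v := prolonged_field A b z.
have im : (i < m)%N by lia.
(* The rows along the line are x_k (1 + a A); the Cayley rotation carries those at -a to those at a.
   So the derivatives along v and -v agree, and both vanish. *)
have ev : 'D_(-1 *: v) (jcurv_iter h i : _ -> R^o) z = 'D_v (jcurv_iter h i : _ -> R^o) z.
  apply: derive_ext => a; have [Q [QQ dQ QE]] := antisym_cayley a AT.
  apply/esym/(jcurv_iter_rot QQ dQ him) => k ki.
  have km : (k < m)%N by lia.
  rewrite scalerA mulrN1 !jder_affine jder_prolonged //.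
  have E (c : R) : c *: (jder z k *m A) + jder z k = jder z k *m (1%:M + c *: A).
    by rewrite mulmxDr mulmx1 -scalemxAr addrC.
  by rewrite !E QE scaleNr mulmxA.
move: ev; rewrite deriveZ_dir; last exact: differentiable_jcurv_iter.
rewrite scaleN1r => /eqP; rewrite -subr_eq0 -opprD oppr_eq0 -mulr2n mulrn_eq0 /=.
exact: eqP.
Qed.

End prolonged_derivative.

(** * Total derivatives of the curvatures *)

Section jet_projections.
Context {R : realType} {m : nat}.

Lemma jrow_proj r l (z : jets R m r) k : (k <= l)%N -> jrow (jet_proj l z) k = jrow z k.
Proof. by move=> kl; rewrite /jrow rowK inordK. Qed.

Lemma jder_proj r l (z : jets R m r) k : (k < l)%N -> jder (jet_proj l z) k = jder z k.
Proof. exact: jrow_proj. Qed.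

Lemma jet_proj_affine r l (v z : jets R m r) (a : R) :
  jet_proj l (a *: v + z) = a *: jet_proj l v + jet_proj l z.
Proof.
apply: (f_equal2 pair) => //; apply/row_matrixP => k.
by rewrite rowK /= !linearD !linearZ /= !rowK.
Qed.

Lemma differentiable_jet_proj r l (z : jets R m r) :
  differentiable (jet_proj l : jets R m r -> jets R m l) z.
Proof.
pose f (M : 'M[R]_(r.+1, m)) : 'M[R]_(l.+1, m) := \matrix_(j < l.+1) row (inord j) M.
have flin : linear f.
  move=> a M N; apply/row_matrixP => j.
  by rewrite rowK !linearD !linearZ /= !rowK.
pose fL : {linear 'M[R]_(r.+1, m) -> 'M[R]_(l.+1, m)} :=
  HB.pack f (GRing.isLinear.Build _ _ _ _ f flin).
apply: (@differentiable_pair _ _ _ _ (fun w : jets R m r => w.1) (fun w => fL w.2)).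
  by apply: linear_differentiable => x; exact: cvg_fst.
apply: (@differentiable_comp _ _ _ _ (snd : jets R m r -> _) fL).
  by apply: linear_differentiable => x; exact: cvg_snd.
exact: mx_linear_differentiable.
Qed.

Lemma near_frenet_proj r (z : jets R m r) : frenet_dom R m (jet_proj m z) ->
  \forall w \near z, frenet_dom R m (jet_proj m w).
Proof.
move=> Uz; have := differentiable_continuous (differentiable_jet_proj m z).
by apply; apply: open_nbhs_nbhs; split=> //; exact: open_frenet_dom.
Qed.

(** The total derivative at z is a directional derivative at the projection of z. By induction the
    differentiated function may be replaced nearby by one pulled back from [J^m], and then the two
    directions need only agree in the rows that it reads. *)
Lemma iter_total_derivative_jcurv h i (z : jets R m (h + m)) : (h + i < m)%N ->
  frenet_dom R m (jet_proj m z) ->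
  iter_total_derivative h (varkappa i) z = jcurv_iter h i (jet_proj m z).
Proof.
elim: h z => [|h IH] z him Uz.
  have E : jet_proj m z = z.
    case: z {Uz} => t M; apply: (f_equal2 pair) => //.
    by apply/row_matrixP => k; rewrite rowK inord_val.
  by rewrite E in Uz *; rewrite /= varkappaE //; lia.
have im : (i < m)%N by lia.
set y := jet_proj (h + m) z.
have yE : jet_proj m y = jet_proj m z.
  apply: (f_equal2 pair) => //; apply/row_matrixP => k; rewrite [LHS]rowK [RHS]rowK.
  by apply: (@jrow_proj _ (h + m) z k); have := ltn_ord k; lia.
have Uy : frenet_dom R m (jet_proj m y) by rewrite yE.
pose g (w : jets R m (h + m)) : R^o := jcurv_iter h i (jet_proj m w).
have dg : differentiable (g : jets R m (h + m) -> R^o) y.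
  apply: (@differentiable_comp _ _ _ _ (jet_proj m : jets R m (h + m) -> _)
    (jcurv_iter h i : _ -> R^o)); first exact: differentiable_jet_proj.
  exact: differentiable_jcurv_iter.
have Dg v : 'D_v (iter_total_derivative h (varkappa i) : jets R m (h + m) -> R^o) y =
            'D_v (g : _ -> R^o) y.
  apply: near_eq_derive; near=> w; apply: IH; first exact: ltnW.
  by near: w; exact: near_frenet_proj.
(* The total derivative as a vector: time component 1 and the rows of z moved down by one order. *)
pose W : jets R m (h + m) := (1, \matrix_l row (lift ord0 l) z.2).
have -> : iter_total_derivative h.+1 (varkappa i) z = 'D_W (g : _ -> R^o) y.
  rewrite derive_jetE //= mul1r /total_derivative -/y Dg; congr (_ + _).
  by apply: eq_bigr => l _; apply: eq_bigr => j _; rewrite Dg !mxE.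
apply: (@derive_ext _ _ (jets R m m) _ _ (jcurv_iter h i : _ -> R^o)) => a.
rewrite /g jet_proj_affine yE; apply: jcurv_iter_ext; first exact: ltnW.
move=> k ki; rewrite !jder_affine; congr (_ *: _ + _).
rewrite jder_proj; last by lia.
rewrite jder_shift; last by lia.
rewrite (_ : (k.+1 < m)%N); last by lia.
rewrite jder_proj; last by lia.
rewrite /jder /jrow rowK; congr (row _ _); apply/val_inj.
have h1 : (k.+1 < (h + m).+1)%N by lia.
have h2 : (k.+2 < (h + m).+2)%N by lia.
by rewrite /= /bump /= !inordK.
Unshelve. all: by end_near. Qed.

End jet_projections.

(** * Linear independence of the differentials *)

Section independence.
Context {R : realType} {m : nat}.
Implicit Types z v : jets R m m.

Definition jet_dir (k : nat) (w : 'rV[R]_m) : jets R m m :=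
  (0, delta_mx (inord k) (0 : 'I_1) *m w).

Lemma jder_dir l (w : 'rV[R]_m) k : (k < m)%N -> (l < m)%N ->
  jder (jet_dir l.+1 w) k = (k == l)%:R *: w.
Proof.
move=> km lm; rewrite /jder /jrow /jet_dir /=.
apply/rowP => j; rewrite !mxE big_ord1 !mxE eqxx andbT.
by rewrite -(inj_eq val_inj) /= !inordK // eqSS.
Qed.

Lemma jcurv_iter_dir0 h i l w z : (h + i < l)%N -> (l < m)%N ->
  'D_(jet_dir l.+1 w) (jcurv_iter h i : _ -> R^o) z = 0.
Proof.
move=> hil lm; rewrite -[RHS](derive0 (jcurv_iter h i : jets R m m -> R^o) z).
apply: derive_ext => a; apply: jcurv_iter_ext => [|k ki]; first by lia.
rewrite !jder_affine jder_dir //; last by lia.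
rewrite (_ : k == l = false); last by lia.
by rewrite scale0r /jder /jrow /= row0 !scaler0.
Qed.

Lemma jcurv_iter_time h i z : (h + i < m)%N ->
  'D_((1, 0) : jets R m m) (jcurv_iter h i : _ -> R^o) z = 0.
Proof.
move=> him; rewrite -[RHS](derive0 (jcurv_iter h i : jets R m m -> R^o) z).
by apply: derive_ext => a; apply: jcurv_iter_ext.
Qed.

(** Moving x_{h+i+2} by a w leaves alone every row read by the h-th iterate but adds a w to row
    h+i+1 of the shifted jet. So the next iterate is affine in a, with slope the derivative of the
    h-th iterate along x_{h+i+1}. *)
Lemma jcurv_iter_dirS h i w z : (h + i < m)%N -> frenet_dom R m z ->
  'D_(jet_dir (h + i).+1 w) (jcurv_iter h i : _ -> R^o) z =
  'D_(jet_dir i.+1 w) (jcurv i : _ -> R^o) z.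
Proof.
move=> + Uz; elim: h => [//|h IH] him; rewrite -IH; last exact: ltnW.
have im : (i < m)%N by lia.
have df := differentiable_jcurv_iter h im Uz.
apply: (@derive_affine _ _ _ _ _ (trunc_total (jcurv_iter h i) z)).
near=> a; rewrite -[LHS]/(trunc_total (jcurv_iter h i) _) /trunc_total [RHS]addrC.
rewrite -[a * _]/(a *: _) -deriveZ_dir // -deriveD_dir //.
apply: derive_ext => c; apply: jcurv_iter_ext => [|k ki]; first exact: ltnW.
rewrite jder_affine [in RHS]jder_affine jder_shift; last by lia.
rewrite (_ : (k.+1 < m)%N); last by lia.
rewrite !jder_affine jder_shift; last by lia.
rewrite (_ : (k.+1 < m)%N); last by lia.
rewrite !jder_dir; try lia.
rewrite addSn eqSS (_ : (k == (h + i).+1) = false); last by lia.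
by rewrite scale0r scaler0 add0r.
Unshelve. all: by end_near. Qed.

End independence.

Section row_operation.
Context {R : realType} {m n : nat}.
Variables (b b' : nat -> 'rV[R]_m) (j : nat) (a : R).
Hypotheses (jn : (j <= n)%N) (bn : b' n = b n + a *: b j)
  (bk : forall k, (k < n)%N -> b' k = b k).

Let T : 'M[R]_n.+1 := 1%:M + a *: delta_mx ord_max (inord j).

Let mul_row_op : \matrix_(i < n.+1) b' i = T *m \matrix_(i < n.+1) b i.
Proof.
apply/row_matrixP => i; rewrite rowK mulmxDl mul1mx -scalemxAl linearD linearZ /=.
rewrite rowK row_mul.
have -> : row i (delta_mx ord_max (inord j)) =
    (i == ord_max)%:R *: delta_mx 0 (inord j) :> 'rV[R]_n.+1.
  by apply/rowP => l; rewrite !mxE eqxx /= -natrM mulnb.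
rewrite -scalemxAl -rowE rowK inordK //.
have [->|im] := eqVneq i ord_max; first by rewrite bn scale1r.
rewrite scale0r scaler0 addr0 bk // ltn_neqAle -ltnS ltn_ord andbT.
by apply: contra im => /eqP h; apply/eqP/val_inj.
Qed.

Let det_row_op : \det T = 1 + a *+ (j == n).
Proof.
rewrite det_trig.
  rewrite big_ord_recr /= big1 ?mul1r => [|i _].
    by rewrite !mxE eqxx -(inj_eq val_inj) /= inordK // mulr_natr eq_sym.
  by rewrite !mxE eqxx -(inj_eq val_inj) /= ltn_eqF // mulr0 addr0.
apply/is_trig_mxP => i l il; rewrite !mxE.
have -> : (i == l) = false by apply/negbTE; rewrite neq_ltn il.
have -> : (i == ord_max) = false.
  by apply/negbTE; rewrite -(inj_eq val_inj) /= neq_ltn (leq_trans il) // -ltnS ltn_ord.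
by rewrite mulr0 addr0.
Qed.

(** The row operation has determinant 1 for j < n and 1 + a for j = n; the Gram version sees it only
    up to sign. *)
Lemma vol_row_op : (n < m)%N ->
  vol n.+1 b' =
  (if (n.+1 < m)%N then `|1 + a *+ (j == n)| else 1 + a *+ (j == n)) * vol n.+1 b.
Proof.
move=> nm; rewrite /vol; case: ltnP => nm'.
  rewrite mul_row_op trmx_mul mulmxA -[T *m _ *m _]mulmxA !det_mulmx det_tr det_row_op.
  by rewrite mulrAC -expr2 sqrtrM ?sqr_ge0 // sqrtr_sqr.
have E : m = n.+1 by apply/anti_leq; rewrite nm' nm.
(* Here m = n+1 is a proved equation, not a conversion, so the square determinant has to be reached
   through a cast. *)
have K1 k (mk : m = k) (f : nat -> 'rV[R]_m) : \det (\matrix_(i < m) f i) =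
    \det (castmx (erefl, mk) (\matrix_(i < k) f i)).
  by case: _ / mk; rewrite castmx_id.
have K2 k (mk : m = k) (S : 'M[R]_k) (B : 'M[R]_(k, m)) :
    \det (castmx (erefl, mk) (S *m B)) = \det S * \det (castmx (erefl, mk) B).
  by case: _ / mk S B => S B; rewrite !castmx_id det_mulmx.
by rewrite !(K1 _ E) mul_row_op K2 det_row_op.
Qed.

End row_operation.

Lemma sum_option (R : realType) (J : finType) (G : option J -> R) :
  \sum_o G o = G None + \sum_j G (Some j).
Proof.
rewrite (bigD1 None) //=; congr (_ + _).
rewrite (reindex_omap (@Some J) id) /=; last by case.
by apply: eq_bigl => j; rewrite eqxx.
Qed.

Lemma curv_scale (R : realType) (m i : nat) (b b' : nat -> 'rV[R]_m) (c : R) :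
  (forall n, (n <= i)%N -> vol n b' = vol n b) -> vol i.+1 b' = c * vol i.+1 b ->
  curv i b' = c * curv i b.
Proof.
case: i => [|i] E E1; rewrite /curv E1 //.
by rewrite !E //= !mulrA.
Qed.

Section jcurv_derivatives.
Context {R : realType} {m : nat}.
Implicit Types z : jets R m m.

Lemma jder_dir_affine l (w : 'rV[R]_m) z (a : R) k : (k < m)%N -> (l < m)%N ->
  jder (a *: jet_dir l.+1 w + z) k = jder z k + (a *+ (k == l)) *: w.
Proof.
move=> km lm; rewrite jder_affine jder_dir // addrC scalerA; congr (_ + _ *: _).
by rewrite mulr_natr.
Qed.

(** In [curv i] only the factor [vol i.+1] reads x_{i+1}. Adding an earlier row leaves it fixed;
    adding a x_{i+1} itself scales it by 1 + a. *)
Lemma jcurv_dir i j z : (i < m)%N -> (j <= i)%N ->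
  'D_(jet_dir i.+1 (jder z j)) (jcurv i : _ -> R^o) z = (j == i)%:R * jcurv i z.
Proof.
move=> im ji; apply: (@derive_affine _ _ _ _ _ (jcurv i z)).
(* For small a the absolute value in the row-operation formula may be dropped. *)
have pos : \forall a \near (0 : R), 0 < 1 + a *+ (j == i).
  near=> a; have : `|a| < 1 by near: a; exact: (@nbhs0_lt R R^o 1 ltr01).
  by rewrite ltr_norml => /andP[a1 _]; case: (j == i); rewrite ?mulr1n ?mulr0n; lra.
near=> a; pose b' := jder (a *: jet_dir i.+1 (jder z j) + z).
have Eb k : (k < m)%N -> b' k = jder z k + (a *+ (k == i)) *: jder z j.
  by move=> km; rewrite /b' jder_dir_affine.
have E n : (n <= i)%N -> vol n b' = vol n (jder z).
  move=> ni; apply: vol_ext => [|k kn]; first exact: leq_trans ni (ltnW im).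
  by rewrite Eb ?ltn_eqF ?mulr0n ?scale0r ?addr0 //; lia.
have a0 : 0 < 1 + a *+ (j == i) by near: a.
have E1 : vol i.+1 b' = (1 + a *+ (j == i)) * vol i.+1 (jder z).
  rewrite (@vol_row_op _ _ i (jder z) b' j a) //.
  - by case: ifP => // _; rewrite gtr0_norm.
  - by rewrite Eb // eqxx.
  - by move=> k ki; rewrite Eb ?ltn_eqF ?mulr0n ?scale0r ?addr0 //; lia.
rewrite -[LHS]/(curv i b') (curv_scale E E1) mulrDl mul1r; congr (_ + _).
by rewrite -[a *+ _]mulr_natr mulrA.
Unshelve. all: by end_near. Qed.

Lemma jcurv_gt0 i z : (i.+1 < m)%N -> frenet_dom R m z -> 0 < jcurv i z.
Proof.
move=> im /frenet_domP fr; rewrite /jcurv /curv.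
by case: i im => [|i] im; rewrite ?mulr_gt0 ?invr_gt0 ?mulr_gt0 ?vol_gt0 //; lia.
Qed.

End jcurv_derivatives.

(** Take w nonzero and orthogonal to all b_i. Were the cross product 0, the rows b_i and w would be
    dependent; pairing a relation with w kills the coefficient of w, and freeness kills the
    others. *)
Lemma cross_neq0 (R : realType) (n : nat) (b : nat -> 'rV[R]_n.+1) :
  row_free (\matrix_(i < n) b i) -> cross b != 0.
Proof.
move=> fr.
have : kermx (\matrix_(i < n) b i)^T != 0.
  by rewrite kermx_eq0 /row_free ltn_eqF // ltnS rank_leq_col.
case/rowV0Pn => w wk w0.
have wb i : (i < n)%N -> dot (b i) w = 0.
  move=> lt_in.
  have /sub_kermxP/(congr1 (fun M : 'rV[R]_n => M 0 (Ordinal lt_in))) := wk.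
  rewrite !mxE => h; rewrite dotC dotE -[RHS]h.
  by apply: eq_bigr => j _; rewrite !mxE.
apply/eqP => c0; have := dot_cross b w; rewrite c0 dot0r => /esym/eqP/det0P[u u0].
rewrite mulmx_sum_row big_ord_recr /= !rowK /with_last /= ltnn => uE.
have := congr1 (fun v => dot v w) uE; rewrite dotDl dot_suml dot0l big1 ?add0r => [|i _].
  rewrite dotZl => /eqP; rewrite mulf_eq0 => /orP[/eqP ul|/eqP/dot_eq0 /eqP]; last first.
    by rewrite (negPf w0).
  move: uE; rewrite ul scale0r addr0 => uE.
  pose u' : 'rV[R]_n := \row_i u 0 (widen_ord (leqnSn n) i).
  have u'0 : u' = 0.
    apply: (row_free_inj fr); rewrite mul0mx mulmx_sum_row -[RHS]uE.
    by apply: eq_bigr => i _; rewrite rowK mxE rowK /with_last /= ltn_ord.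
  case/eqP: u0; apply/rowP => i; rewrite mxE.
  have [lt_in|] := ltnP i n.
    have := congr1 (fun M : 'rV[R]_n => M 0 (Ordinal lt_in)) u'0; rewrite !mxE => <-.
    by congr (u _ _); apply/val_inj.
  move=> ni; rewrite -[RHS]ul; congr (u _ _); apply/val_inj => /=.
  by apply/anti_leq; rewrite ni -ltnS ltn_ord.
by rewrite rowK /with_last /= dotZl ltn_ord wb // mulr0.
Qed.

Lemma vol_cross (R : realType) (n : nat) (b b0 : nat -> 'rV[R]_n.+1) :
  (forall k, (k < n)%N -> b k = b0 k) -> vol n.+1 b = dot (b n) (cross b0).
Proof.
move=> bb; rewrite /vol ltnn dot_cross; congr (\det _); apply/row_matrixP => i.
rewrite !rowK /with_last; case: ltnP => ni; first exact: bb.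
by congr (b _); apply/anti_leq; rewrite ni -ltnS ltn_ord.
Qed.

(** The last curvature may be 0, so scaling the top derivative does not detect it. It is linear in
    that derivative, though, and its slope along the normal N is <N, N> times a nonzero factor. *)
Lemma jcurv_dir_last (R : realType) (n : nat) (z : jets R n.+1 n.+1) :
  frenet_dom R n.+1 z ->
  exists w, 'D_(jet_dir n.+1 w) (jcurv n : _ -> R^o) z != 0.
Proof.
move=> Uz; have /frenet_domP fr := Uz; pose N := cross (jder z).
have NN : dot N N != 0.
  by apply/negP => /eqP/dot_eq0 N0; have := cross_neq0 fr; rewrite -/N N0 eqxx.
(* C collects the factors of [curv n] that do not involve the top row; for n = 0 there are none. *)
pose C := if n is 0 then 1 else vol n.-1 (jder z) /
  (vol 1 (jder z) * (vol n (jder z) * vol n (jder z))).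
have C0 : C != 0.
  rewrite /C; case: n z Uz fr @N NN @C => [|n] z Uz fr N NN C; first exact: oner_neq0.
  by rewrite gt_eqF // divr_gt0 ?mulr_gt0 ?vol_gt0 //; lia.
have curvE b : (forall k, (k < n)%N -> b k = jder z k) -> curv n b = dot (b n) N * C.
  move=> bb; have E k : (k <= n)%N -> vol k b = vol k (jder z).
    move=> kn; apply: vol_ext => [|l lk]; first exact: leqW.
    by apply: bb; apply: leq_trans lk kn.
  have V : vol n.+1 b = dot (b n) N by exact: vol_cross.
  move: V E; rewrite /curv /C; case: n z b {Uz fr C C0 bb} @N {NN} => [|n] z b N V E.
    by rewrite V mulr1.
  by rewrite V !E // [RHS]mulrA.
exists N; rewrite (@derive_affine _ _ _ _ _ (jcurv n z) (dot N N * C)) ?mulf_neq0 //.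
near=> a; rewrite /jcurv (curvE (jder z)) // curvE => [|k kn]; last first.
  by rewrite jder_dir_affine ?ltn_eqF ?mulr0n ?scale0r ?addr0 //; lia.
by rewrite jder_dir_affine // eqxx mulr1n dotDl dotZl mulrDl mulrA.
Unshelve. all: by end_near. Qed.

Section independence_of_derivatives.
Context {R : realType} {m : nat}.
Implicit Types z : jets R m m.

Let P := {p : 'I_m * 'I_m | (p.1 + p.2 <= m.-1)%N}.

Lemma jcurv_iter_indep z (c : P -> R) : frenet_dom R m z ->
  (forall v, \sum_p c p * 'D_v (jcurv_iter (val p).1 (val p).2 : _ -> R^o) z = 0) ->
  forall p, c p = 0.
Proof.
move=> Uz c0.
(* A lexicographic order, since i < m: pairs with larger h+i come earlier and, among equal sums,
   those with smaller i. *)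
pose mu (p : P) := ((m - ((val p).1 + (val p).2)) * m + (val p).2)%N.
suff H n : forall p, mu p = n -> c p = 0 by move=> p; exact: H erefl.
elim/ltn_ind: n => n IH p pn.
have {}IH q : (mu q < mu p)%N -> c q = 0 by move=> qp; apply: IH erefl; rewrite -pn.
have hip : ((val p).1 + (val p).2 <= m.-1)%N := valP p.
move: hip (ltn_ord (val p).1) (ltn_ord (val p).2).
set h := nat_of_ord (val p).1; set i := nat_of_ord (val p).2 => him hm im.
(* The test vector: kappa_i must react to w in slot i+1, and no later kappa_j may react to w in slot
   j+1. Below the last index w = x_{i+1} does this, being an earlier row for each later curvature;
   at the last index there is no later curvature. *)
have [w Dp Dq] : exists2 w,
    'D_(jet_dir i.+1 w) (jcurv i : _ -> R^o) z != 0 &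
    forall j, (i < j < m)%N -> 'D_(jet_dir j.+1 w) (jcurv j : _ -> R^o) z = 0.
  have [im'|mi] := ltnP i.+1 m.
    exists (jder z i); first by rewrite jcurv_dir // eqxx mul1r gt_eqF // jcurv_gt0.
    by move=> j ij; rewrite jcurv_dir ?ltn_eqF ?mul0r //; lia.
  have E : m = i.+1 by lia.
  move: (i) E => k E; clear -Uz E; subst m.
  have [w Dw] := jcurv_dir_last Uz; exists w => // j; lia.
have := c0 (jet_dir (h + i).+1 w); rewrite (bigD1 p) //= big1 ?addr0.
  move/eqP; rewrite mulf_eq0 => /orP[/eqP //|].
  have hlt : (h + i < m)%N by lia.
  by rewrite (jcurv_iter_dirS w hlt Uz) (negPf Dp).
move=> q qp.
have hiq : ((val q).1 + (val q).2 <= m.-1)%N := valP q.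
move: hiq (ltn_ord (val q).1) (ltn_ord (val q).2).
have : ((val q).1 != h :> nat) || ((val q).2 != i :> nat).
  rewrite -negb_and; apply: contra qp => /andP[/eqP e1 /eqP e2].
  apply/eqP/val_inj; move: e1 e2; rewrite /h /i.
  by case: (val q) (val p) => a b [a' b'] /= /val_inj -> /val_inj ->.
have muE : mu q = ((m - ((val q).1 + (val q).2)) * m + (val q).2)%N by [].
have mupE : mu p = ((m - (h + i)) * m + i)%N by [].
move: (IH q); rewrite muE mupE.
set h' := nat_of_ord (val q).1; set i' := nat_of_ord (val q).2 => IHq ne him' hm' im'.
have [lt|gt|eq_] := ltngtP (h' + i') (h + i).
- by rewrite jcurv_iter_dir0 ?mulr0 //; lia.
- by rewrite IHq ?mul0r //; nia.
- have [lt|gt|eqi] := ltngtP i' i.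
  + by rewrite IHq ?mul0r // eq_ ltn_add2l.
  + rewrite -eq_ jcurv_iter_dirS //; last by lia.
    by rewrite Dq ?mulr0 //; lia.
  + by exfalso; lia.
Qed.

End independence_of_derivatives.

(** * The basis of invariants *)

Lemma sum_ord_rev m n : (n <= m)%N ->
  ((\sum_(i < n) (m - i)) * 2 = n * (2 * m - n + 1))%N.
Proof.
elim: n => [|n IH] nm; first by rewrite big_ord0.
rewrite big_ord_recr /= mulnDl IH; last exact: ltnW.
nia.
Qed.

Lemma card_triangle m : (0 < m)%N ->
  (#|{: {p : 'I_m * 'I_m | (p.1 + p.2 <= m.-1)%N}}| * 2 = m * m.+1)%N.
Proof.
move=> m0; rewrite card_sig -sum1_card.
rewrite (eq_bigl (fun p : 'I_m * 'I_m => true && (p.2 < m - p.1)%N)); last first.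
  by move=> p; rewrite inE /=; have := ltn_ord p.1; lia.
rewrite -(pair_big_dep (fun i : 'I_m => true) (fun i j : 'I_m => (j < m - i)%N)
            (fun _ _ => 1%N)) /=.
rewrite (eq_bigr (fun i : 'I_m => (m - i)%N)) => [|i _].
  by rewrite sum_ord_rev //; lia.
by rewrite (big_ord_narrow (leq_subr i m)) sum1_card card_ord.
Qed.

(** Forms that vanish on W are determined by their values on a basis of a complement. Independence
    makes this matrix of values row-free, so there are at most codim W of them. *)
Lemma indep_forms_bound (R : realType) (V : vectType R) (W : {vspace V})
    (J : finType) (phi : J -> V -> R) :
  (forall j, linear (phi j : V -> R^o)) ->
  (forall j v, v \in W -> phi j v = 0) ->
  (forall c : J -> R, (forall v, \sum_j c j * phi j v = 0) -> forall j, c j = 0) ->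
  (#|J| + \dim W <= dim V)%N.
Proof.
move=> lin phiW indep.
pose A : 'M[R]_(#|J|, \dim W^C) := \matrix_(a, k) phi (enum_val a) (vbasis W^C)`_k.
suff : row_free A.
  move=> /eqP rA; have := rank_leq_col A; rewrite rA dimv_compl dimvf.
  have W_le := dimvS (subvf W); rewrite dimvf in W_le.
  by rewrite leq_subRL // addnC.
rewrite -kermx_eq0; apply/rowV0P => u /sub_kermxP uA.
suff u0 : forall j, u 0 (enum_rank j) = 0.
  by apply/rowP => a; rewrite mxE -[a]enum_valK.
apply: (indep (fun j => u 0 (enum_rank j))) => v.
have phiD j x y : phi j (x + y) = phi j x + phi j y.
  by have := lin j 1 x y; rewrite !scale1r.
have phi0 j : phi j 0 = 0 by apply: phiW; apply: mem0v.
have phiZ j a x : phi j (a *: x) = a * phi j x.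
  by have := lin j a x 0; rewrite phi0 !addr0.
have phi_sum j n (F : 'I_n -> V) : phi j (\sum_i F i) = \sum_i phi j (F i).
  by apply: (big_morph (phi j)).
have : v \in (W + W^C)%VS by rewrite addv_complf memvf.
case/memv_addP => w wW [w' w'C ->].
have Ek (k : 'I_(\dim W^C)) : \sum_j u 0 (enum_rank j) * phi j (vbasis W^C)`_k = 0.
  have := congr1 (fun M : 'rV[R]_(\dim W^C) => M 0 k) uA; rewrite [LHS]mxE [RHS]mxE => h.
  rewrite -[RHS]h (reindex (enum_val : 'I_#|J| -> J)) /=; last exact/onW_bij/enum_val_bij.
  by apply: eq_bigr => a _; rewrite enum_valK mxE.
rewrite (coord_vbasis w'C).
rewrite (eq_bigr (fun j => \sum_k coord (vbasis W^C) k w' *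
    (u 0 (enum_rank j) * phi j (vbasis W^C)`_k))) => [|j _].
  rewrite exchange_big big1 // => k _; rewrite -mulr_sumr Ek mulr0 //.
rewrite phiD phiW // add0r phi_sum mulr_sumr; apply: eq_bigr => k _.
by rewrite phiZ mulrCA.
Qed.

Lemma derive_linear (R : realType) (V W : normedModType R) (f : V -> W) z :
  differentiable f z -> linear (fun v => 'D_v f z).
Proof. by move=> df a u v; rewrite deriveD_dir // deriveZ_dir. Qed.

Section curvature_basis.
Context {R : realType} {m : nat}.
Hypothesis m0 : (0 < m)%N.

Let P := {p : 'I_m * 'I_m | (p.1 + p.2 <= m.-1)%N}.

Definition curvature_system : option P -> jets R m m -> R :=
  adjoin (fun p : P => jcurv_iter (val p).1 (val p).2) (@time R m m).

Let index_lt (p : P) : ((val p).1 + (val p).2 < m)%N.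
Proof. by have : ((val p).1 + (val p).2 <= m.-1)%N := valP p; lia. Qed.

Lemma time_invariant : diff_invariant (frenet_dom R m) (@time R m m).
Proof.
split; first exact: open_frenet_dom.
  apply: (smooth_expr_smooth (@open_frenet_dom R m) (smooth_jet_time _)).
  by [].
move=> X Xr kX; have [A [b [AT XE]]] := killing_affine kX.
rewrite XE => /(prolongation_affineP AT) -> z _.
by have [_ ->] := is_derive_jet_time z (prolonged_field A b z).
Qed.

Lemma jcurv_iter_diff_invariant h i : (h + i < m)%N ->
  diff_invariant (frenet_dom R m) (jcurv_iter (R := R) h i).
Proof.
move=> him; split; first exact: open_frenet_dom.
  by apply: smooth_on_jcurv_iter; lia.
move=> X Xr kX; have [A [b [AT XE]]] := killing_affine kX.
rewrite XE => /(prolongation_affineP AT) -> z Uz.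
exact: jcurv_iter_invariant.
Qed.

Lemma curvature_system_invariant o : diff_invariant (frenet_dom R m) (curvature_system o).
Proof.
by case: o => [p|]; [exact: jcurv_iter_diff_invariant|exact: time_invariant].
Qed.

Lemma curvature_system_indep : fun_indep (frenet_dom R m) curvature_system.
Proof.
move=> z Uz c H.
have cN : c None = 0.
  have := H (1, 0); rewrite sum_option big1 ?addr0 => [|p _].
    by have [_ ->] := is_derive_jet_time z ((1, 0) : jets R m m); rewrite mulr1.
  by rewrite jcurv_iter_time ?mulr0.
have cS : forall p, c (Some p) = 0.
  apply: (jcurv_iter_indep Uz) => v.
  by have := H v; rewrite sum_option cN mul0r add0r.
by case.
Qed.

(** One point of U' suffices. There the differentials annihilate a space of dimension m + m(m-1)/2,
    and with g they number m(m+1)/2 + 2: together m(m+1) + 2, one more than the dimension of the jet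
    space. *)
Lemma curvature_system_maximal (U' : set (jets R m m)) (g : jets R m m -> R) :
  U' `<=` frenet_dom R m -> U' !=set0 -> diff_invariant U' g ->
  ~ fun_indep U' (adjoin curvature_system g).
Proof.
move=> U'U [z U'z] [opU' sg ginv] ind.
have Uz := U'U _ U'z.
have dsys o : differentiable (adjoin curvature_system g o : jets R m m -> R^o) z.
  case: o => [j|]; last exact: smooth_on_differentiable sg U'z.
  by have [_ sm _] := curvature_system_invariant j; apply: smooth_on_differentiable sm Uz.
have fr : (m.-1 <= \rank (row' ord0 z.2))%N.
  have /frenet_domP /eqP <- := Uz.
  have -> : \matrix_(k < m.-1) jder z k =
      (pid_mx m.-1 : 'M[R]_(m.-1, m)) *m \matrix_(k < m) jder z k.
    by apply: rows_pid_mx; lia.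
  apply: leq_trans (mxrankM_maxr _ _) _.
  suff -> : \matrix_(k < m) jder z k = row' ord0 z.2 by [].
  apply/row_matrixP => k; rewrite rowK row_row' /jder /jrow; congr (row _ _).
  by apply/val_inj; rewrite /= inordK // ltnS ltn_ord.
have [W [DW dW]] := has_dim_Ddist_large fr.
have : (#|{: option (option P)}| + \dim W <= dim (jets R m m))%N.
  apply: (@indep_forms_bound R _ W _
    (fun o v => 'D_v (adjoin curvature_system g o : jets R m m -> R^o) z)).
  - by move=> o; exact: derive_linear.
  - move=> o v /DW [X [Xr [kX pX ->]]].
    case: o => [j|]; last exact: ginv kX pX _ U'z.
    by have [_ _ H] := curvature_system_invariant j; exact: H kX pX _ Uz.
  - exact: ind.
rewrite dW !card_option.
have := card_triangle m0; set N := #|_|.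
have -> : dim (jets R m m) = (1 + m.+1 * m)%N by rewrite /dim /= dim_matrix.
have := bin2 m; have : ((m * m.-1)./2).*2 = (m * m.-1)%N.
  by rewrite -[RHS]odd_double_half oddM -subn1 oddB // addbT andbN.
case: m m0 => // k _ /=; nia.
Qed.

End curvature_basis.

Theorem theorem8p1 (R : realType) (m : nat) (hm : (0 < m)%N) :
  (forall (I : set R) (s : R -> 'rV[R]_m) (t0 : R),
     smooth_curve I s -> I t0 -> frenet_jets R m (jet m.-1 s t0) ->
     (forall r : nat, (1 <= r <= m.-1)%N ->
        has_dim (Ddist (jet r s t0)) (m + ((2 * m - r - 1) * r)./2)%N) /\
     (forall r : nat, (m <= r)%N ->
        has_dim (Ddist (jet r s t0)) (m + 'C(m, 2))%N)) /\
  ((forall r : nat, (1 <= r <= m.-1)%N -> is_Nr R m r (1 + 'C(r.+1, 2))%N) /\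
   (forall r : nat, (m <= r)%N ->
      is_Nr R m r (1 + (m * (2 * r - m + 1))./2)%N)) /\
  (exists F : nat -> nat -> jets R m m -> R,
     (forall h i : nat, (h + i <= m.-1)%N ->
        forall z : jets R m (h + m), frenet_dom R m (jet_proj m z) ->
          iter_total_derivative h (varkappa i) z = F h i (jet_proj m z)) /\
     is_basis (frenet_dom R m)
       (adjoin (fun p : {p : 'I_m * 'I_m | (p.1 + p.2 <= m.-1)%N} =>
                  F (val p).1 (val p).2)
               (@time R m m))).
Proof.
split; [|split].
- move=> I s t0 sm It /(frenet_jetsP sm It) fr; split=> r hr.
    by apply: has_dim_Ddist_small; apply: frenet_rank_small fr _ _; lia.
  by apply: has_dim_Ddist_large; apply: frenet_rank_large fr _ _; lia.
- by split=> r hr; [exact: is_Nr_small|exact: is_Nr_large].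
- exists (fun h i => jcurv_iter h i); split.
    by move=> h i hi z Uz; apply: iter_total_derivative_jcurv => //; lia.
  split; first exact: curvature_system_invariant.
    exact: curvature_system_indep.
  exact: curvature_system_maximal.
Qed.
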